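(* Let $\mathbb{K}=\mathbb{R}$ or $\mathbb{C}$ and let $F(z,w)=\sum_{\alpha\in\mathbb{N}^n}P_\alpha(z)w^\alpha$, where $z=(z_1,\ldots,z_n)$, $w=(w_1,\ldots,w_n)$, be a formal power series in $w$ with coefficients $P_\alpha\in\mathbb{K}[z_1,\ldots,z_n]$. Then $F(z,w)\in\overline{\mathcal{H}}_{2n}(\mathbb{K})$ if and only if $$\sum_{\alpha\le\beta}(\beta)_\alpha P_\alpha(z)w^\alpha\in\mathcal{H}_{2n}(\mathbb{K})\cup\{0\}$$ for all $\beta\in\mathbb{N}^n$.
   Context: $H=\{z\in\mathbb{C}:\Im(z)>0\}$. $\mathcal{H}_m(\mathbb{C})$ is the set of polynomials in $m$ variables that are non-zero whenever all variables lie in $H$, and $\mathcal{H}_m(\mathbb{R})$ those with real coefficients. $\overline{\mathcal{H}}_m(\mathbb{C})$ is the class of entire functions in $m$ variables that are limits, uniformly on compact sets, of polynomials in $\mathcal{H}_m(\mathbb{C})$; $\overline{\mathcal{H}}_m(\mathbb{R})$ consists of those with real coefficients. A formal power series belongs to such a class if it defines an entire function in it. $\alpha\le\beta$ means $\alpha_i\le\beta_i$ for all $i$; $(\beta)_\alpha=\beta!/(\beta-\alpha)!$ if $\alpha\le\beta$ and $0$ otherwise, with $\beta!=\prod\beta_i!$. *)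

(* Defs.v *)
From HB Require Import structures.
From mathcomp Require Import all_boot all_order all_algebra.
From mathcomp Require Import reals complex.
From mathcomp Require Import mpoly.

Set Implicit Arguments.
Unset Strict Implicit.
Unset Printing Implicit Defensive.

Import Order.TTheory GRing.Theory Num.Theory.
Local Open Scope ring_scope.
Local Open Scope complex_scope.

Inductive Kfield := Kreal | Kcomplex.

Section Defs.
Variable R : realType.
Local Notation C := (R[i]).

Definition inK (K : Kfield) (c : C) : bool :=
  if K is Kreal then Im c == 0 else true.

Definition mpoly_over (K : Kfield) (m : nat) (p : {mpoly C[m]}) : Prop :=
  forall mu : 'X_{1..m}, inK K (p@_mu).

Definition stable (m : nat) (p : {mpoly C[m]}) : Prop :=
  forall v : 'I_m -> C, (forall i, 0 < Im (v i)) -> p.@[v] != 0.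

Definition Hpoly (K : Kfield) (m : nat) (p : {mpoly C[m]}) : Prop :=
  stable p /\ mpoly_over K p.

(* f : C^m -> C is a limit, uniformly on compact sets, of polynomials in
   H_m(C).  Every compact subset of C^m lies in a closed polydisc
   {v | forall i, |v i| <= r}, and conversely these polydiscs are compact. *)
Definition Hbar_C (m : nat) (f : ('I_m -> C) -> C) : Prop :=
  exists ps : nat -> {mpoly C[m]},
    (forall k, stable (ps k)) /\
    forall (r eps : R), 0 < eps -> exists N : nat, forall k : nat, (N <= k)%N ->
      forall v : 'I_m -> C, (forall i, `|v i| <= r%:C) ->
        `|(ps k).@[v] - f v| < eps%:C.

Definition zpart (n : nat) (v : 'I_(n + n) -> C) : 'I_n -> C :=
  fun i => v (lshift n i).
Definition wpart (n : nat) (v : 'I_(n + n) -> C) : 'I_n -> C :=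
  fun i => v (rshift n i).

Definition series_term (n : nat) (P : 'X_{1..n} -> {mpoly C[n]})
  (a : 'X_{1..n}) (v : 'I_(n + n) -> C) : C :=
  (P a).@[zpart v] * \prod_(i < n) (wpart v i) ^+ (a i).

Definition partial_sum (n : nat) (P : 'X_{1..n} -> {mpoly C[n]})
  (N : nat) (v : 'I_(n + n) -> C) : C :=
  \sum_(a : 'X_{1..n < N}) series_term P a v.

(* The formal power series defines the (entire) function f: it converges
   absolutely at every point of C^(2n), with sum f. *)
Definition series_defines (n : nat) (P : 'X_{1..n} -> {mpoly C[n]})
  (f : ('I_(n + n) -> C) -> C) : Prop :=
  forall v : 'I_(n + n) -> C,
    (exists B : R, forall N : nat,
        \sum_(a : 'X_{1..n < N}) `|series_term P a v| <= B%:C) /\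
    (forall eps : R, 0 < eps -> exists N0 : nat, forall N : nat, (N0 <= N)%N ->
        `|partial_sum P N v - f v| < eps%:C).

Definition series_in_Hbar (K : Kfield) (n : nat)
  (P : 'X_{1..n} -> {mpoly C[n]}) : Prop :=
  (exists f, series_defines P f /\ Hbar_C f) /\
  (forall a, mpoly_over K (P a)).

Definition ffact_mnm (n : nat) (b a : 'X_{1..n}) : nat :=
  (\prod_(i < n) (b i) ^_ (a i))%N.

Definition trunc_poly (n : nat) (P : 'X_{1..n} -> {mpoly C[n]})
  (b : 'X_{1..n}) : {mpoly C[n + n]} :=
  \sum_(a : 'X_{1..n < (mdeg b).+1} | lem (a : 'X_{1..n}) b)
     ((ffact_mnm b a)%:R *:
        ((P a \mPo [tuple 'X_(lshift n i) | i < n]) *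
         \prod_(i < n) 'X_(rshift n i) ^+ (a i))).

End Defs.

(* Main.v *)
Require Import Defs.
From HB Require Import structures.
From mathcomp Require Import all_boot all_order all_algebra.
From mathcomp Require Import reals complex cyclic separable cyclotomic.
From mathcomp Require Import mpoly ring lra.
From mathcomp.analysis Require sequences exp.

(** Write [T_b] for the operator [w^a |-> (b)_a w^a].

    If [F] is a limit of stable polynomials [p_k], Cauchy's estimates give
    convergence of all coefficients.  In one variable [T_b f] is the reversal of
    [f(-D) X^b] up to sign, so by Gauss-Lucas [T_b] preserves stability; it does
    so in each variable separately.  Applying [T_(g,b)] to [p_k] in the
    variables [(z, w)] bounds the degree, so Hurwitz' theorem is only needed in
    bounded degree, where it follows from an elementary Harnack inequality; then
    [g -> oo] after the rescaling [z / g] restores [T_b F].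

    Conversely [Q_k(z, w) = T_(k,..,k) F(z, w / k)] is stable, and its
    coefficients tend to those of [F].  Around the point [(i,..,i; 0,..,0)] the
    Taylor coefficients of [Q_k] of lowest degree [d], and of degrees [d + 1]
    and [d + 2], involve only finitely many [P_a], hence stay bounded.  Szasz'
    inequality on the rays [t x], with [x] real in [[1, 2]^2n], together with
    Cauchy's and Remez' inequalities, bounds [Q_k] uniformly on polydiscs.  So
    the [P_a(z)] decay geometrically, the series converges, and [Q_k -> F]. *)

(** In the converse [F] is not known to converge, so a bound uniform in [k] can use only finitely
    many coefficients. Szasz' inequality gives such a bound for a one-variable stable polynomial
    with nonzero constant term. At the origin all [P_a] may vanish. At [(i,..,i; 0,..,0)] the part
    of lowest degree [d] does not: its value at [(1,..,1)] is close to the sum of the [P_a(i,..,i)]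
    with [|a| = d], and this sum is nonzero because the lowest part of [F] in [w] is itself stable.
    Dividing by [t ^ d] on a ray leaves a polynomial in [t] whose first three coefficients are the
    homogeneous parts of degree [d], [d + 1], [d + 2]. Directions must be real and positive for
    [t x] to stay in the half-planes; passing from the cube to a polydisc costs a factor [K ^ j] in
    degree [j]. Szasz' bound holds on every disc, so Cauchy's estimate with radius [2 K] absorbs
    this cost. In the forward direction the degrees of the [p_k] in [z] stay unbounded when only [w]
    is truncated, which is why the multiplier acts on [z] as well. *)

Set Implicit Arguments.
Unset Strict Implicit.
Unset Printing Implicit Defensive.
Import Order.TTheory GRing.Theory Num.Theory.
Local Open Scope ring_scope.
Local Notation Re := complex.Re.
Local Notation Im := complex.Im.

(** * Complex modulus *)

Section Modulus.
Variable R : realType.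
Local Notation C := R[i].
Implicit Types x y z : C.

Notation nc := Normc.normc.

Lemma normE z : `|z| = (nc z)%:C%C.
Proof. by []. Qed.
Lemma nc_ge0 z : 0 <= nc z.
Proof. by rewrite -ler0c -normE normr_ge0. Qed.
Lemma nc_eq0 z : (nc z == 0) = (z == 0).
Proof. apply/eqP/eqP => [/Normc.eq0_normc //|->]; exact: Normc.normc0. Qed.
Lemma nc_gt0 z : (0 < nc z) = (z != 0).
Proof. by rewrite lt_neqAle nc_ge0 andbT eq_sym nc_eq0. Qed.
Lemma ncM x y : nc (x * y) = nc x * nc y.
Proof. exact: Normc.normcM. Qed.
Lemma ncX x n : nc (x ^+ n) = nc x ^+ n.
Proof. by elim: n => [|n IH]; rewrite ?Normc.normc1 // !exprS ncM IH. Qed.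
Lemma nc_prod I (r : seq I) (P : pred I) (F : I -> C) :
  nc (\prod_(i <- r | P i) F i) = \prod_(i <- r | P i) nc (F i).
Proof. by apply: (big_morph _ ncM (Normc.normc1 R)). Qed.
Lemma ncD x y : nc (x + y) <= nc x + nc y.
Proof. exact: le_normcD. Qed.
Lemma ncN x : nc (- x) = nc x.
Proof. exact: normcN. Qed.
Lemma ncB x y : nc (x - y) <= nc x + nc y.
Proof. by rewrite -(ncN y) ncD. Qed.
Lemma ncBC x y : nc (x - y) = nc (y - x).
Proof. by rewrite -ncN opprB. Qed.
Lemma ncBD x y z : nc (x - z) <= nc (x - y) + nc (y - z).
Proof. by apply: le_trans (ncD _ _); rewrite addrA subrK. Qed.
Lemma nc_sum I (r : seq I) (P : pred I) (F : I -> C) :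
  nc (\sum_(i <- r | P i) F i) <= \sum_(i <- r | P i) nc (F i).
Proof.
elim/big_rec2: _ => [|i a b _ h]; first by rewrite Normc.normc0.
by apply: le_trans (ncD _ _) _; rewrite lerD2l.
Qed.
Lemma nc_real (a : R) : nc a%:C%C = `|a|.
Proof. by rewrite /= expr0n /= addr0 sqrtr_sqr. Qed.
Lemma nc_nat (n : nat) : nc (n%:R : C) = n%:R.
Proof. by rewrite -(rmorph_nat (real_complex R)) nc_real ger0_norm. Qed.
Lemma ncV x : nc (x^-1) = (nc x)^-1.
Proof. exact: Normc.normcV. Qed.
Lemma nc_i : nc ('i%C : C) = 1.
Proof. by rewrite /= expr0n /= add0r expr1n sqrtr1. Qed.
Lemma nc_sqr z : nc z ^+ 2 = Re z ^+ 2 + Im z ^+ 2.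
Proof. by case: z => a b /=; rewrite sqr_sqrtr // addr_ge0 ?sqr_ge0. Qed.
Lemma nc_Re z : `|Re z| <= nc z.
Proof. by rewrite -lecR; exact: normc_ge_Re. Qed.
Lemma nc_Im z : `|Im z| <= nc z.
Proof.
rewrite -(@ler_pXn2r _ 2) ?nnegrE ?nc_ge0 // nc_sqr real_normK ?num_real //.
by rewrite lerDr sqr_ge0.
Qed.
Lemma nc_ReIm z : nc z <= `|Re z| + `|Im z|.
Proof.
rewrite {1}(complexE z); apply: le_trans (ncD _ _) _.
by rewrite ncM nc_i mul1r !nc_real.
Qed.

Lemma Re_add x y : Re (x + y) = Re x + Re y. Proof. by case: x; case: y. Qed.
Lemma Im_add x y : Im (x + y) = Im x + Im y. Proof. by case: x; case: y. Qed.
Lemma Re_opp x : Re (- x) = - Re x. Proof. by case: x. Qed.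
Lemma Im_opp x : Im (- x) = - Im x. Proof. by case: x. Qed.
Lemma Re_mul x y : Re (x * y) = Re x * Re y - Im x * Im y.
Proof. by case: x; case: y. Qed.
Lemma Im_mul x y : Im (x * y) = Re x * Im y + Im x * Re y.
Proof. by case: x; case: y. Qed.
Lemma Re_sum I (r : seq I) (F : I -> C) : Re (\sum_(i <- r) F i) = \sum_(i <- r) Re (F i).
Proof. by apply: (big_morph _ Re_add). Qed.
Lemma Im_sum I (r : seq I) (F : I -> C) : Im (\sum_(i <- r) F i) = \sum_(i <- r) Im (F i).
Proof. by apply: (big_morph _ Im_add). Qed.
Lemma Im_inv x : Im x^-1 = - Im x / nc x ^+ 2.
Proof. by rewrite nc_sqr; case: x => a b /=; rewrite mulNr. Qed.

Lemma Im_inv_lt0 x : 0 < Im x -> Im x^-1 < 0.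
Proof.
move=> h; rewrite Im_inv mulNr oppr_lt0 divr_gt0 // exprn_gt0 // nc_gt0.
by apply: contraTneq h => ->; rewrite /= ltxx.
Qed.
Lemma Im_inv_ge0 x : Im x <= 0 -> 0 <= Im x^-1.
Proof. by move=> h; rewrite Im_inv divr_ge0 ?sqr_ge0 // oppr_ge0. Qed.

End Modulus.
Notation nc := (@Normc.normc _).

(** * One-variable stability and multipliers *)

Section Univariate.
Variable R : realType.
Local Notation C := R[i].
Implicit Types (p q f g : {poly C}) (s : seq C).

Definition ustable f := forall t : C, 0 < Im t -> f.[t] != 0.

Lemma ustable_neq0 f : ustable f -> f != 0.
Proof.
move=> h; apply: contraNneq (h 'i%C _) => [->|/=]; first by rewrite horner0.
by rewrite ltr01.
Qed.

Lemma poly_factor f : f != 0 ->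
  exists c s, [/\ c != 0, f = c *: \prod_(z <- s) ('X - z%:P) &
    forall z, z \in s -> root f z].
Proof.
move=> f0; have [s fE] := closed_field_poly_normal f.
exists (lead_coef f), s; split; rewrite ?lead_coef_eq0 // => z zs.
by rewrite fE rootZ ?lead_coef_eq0 // root_prod_XsubC.
Qed.

Lemma ustable_factor f : ustable f ->
  exists c s, [/\ c != 0, f = c *: \prod_(z <- s) ('X - z%:P) &
    forall z, z \in s -> Im z <= 0].
Proof.
move=> st; have [c [s [c0 fE rs]]] := poly_factor (ustable_neq0 st).
exists c, s; split=> // z /rs /rootP fz; rewrite leNgt; apply/negP => /st.
by rewrite fz eqxx.
Qed.

(** [S] is the sum of the [(t - z)^-1], each of negative imaginary part because [t - z] lies in the
    upper half-plane. The second alternative is the empty product. *)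
Lemma log_deriv_prod s (t : C) : (forall z, z \in s -> Im z <= 0) -> 0 < Im t ->
  exists2 S : C, (\prod_(z <- s) ('X - z%:P))^`().[t] = S * (\prod_(z <- s) ('X - z%:P)).[t]
    & (Im S < 0) || (nilp s && (S == 0)).
Proof.
move=> + t0; elim: s => [_|a s IH h].
  by exists 0; rewrite ?big_nil ?derivC ?horner0 ?mul0r //= eqxx orbT.
have [|S E hS] := IH; first by move=> z zs; apply: h; rewrite inE zs orbT.
have ha : 0 < Im (t - a) by rewrite Im_add Im_opp subr_gt0 (le_lt_trans _ t0) // h ?mem_head.
have a0 : t - a != 0 by apply: contraTneq ha => ->; rewrite ltxx.
exists ((t - a)^-1 + S).
  rewrite !big_cons derivM derivXsubC mul1r hornerD !hornerM hornerXsubC E.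
  by rewrite [RHS]mulrDl mulKf // [in RHS]mulrCA.
rewrite Im_add orbC /=; have := Im_inv_lt0 ha.
by case/orP: hS => [|/andP[_ /eqP->]] /=; lra.
Qed.

(* Gauss-Lucas: at a point of the upper half-plane [f^`() / f] has negative
   imaginary part, so it cannot equal [- z] with [Im z <= 0]. *)
Lemma ustable_diffop f (z : C) : Im z <= 0 -> ustable f ->
  - f^`() - z *: f = 0 \/ ustable (- f^`() - z *: f).
Proof.
move=> hz st; have [c [s [c0 fE hs]]] := ustable_factor st.
have [/eqP ->|nz] := boolP (- f^`() - z *: f == 0); [by left|right=> t ht].
have [S E hS] := log_deriv_prod hs ht.
have Ef : f^`().[t] = S * f.[t] by rewrite fE derivZ !hornerZ E mulrCA.
have -> : (- f^`() - z *: f).[t] = - ((S + z) * f.[t]) by rewrite !hornerE Ef; ring.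
rewrite oppr_eq0 mulf_neq0 ?st //; case/orP: hS => [hS|/andP[s0 /eqP S0]].
  by apply: contraTneq hS => /(congr1 (@Im R)); rewrite Im_add /=; lra.
(* Here [f] is constant, so the operator gives [- z f], which is nonzero unless [z = 0]. *)
rewrite S0 add0r; apply: contraNneq nz => ->.
by rewrite scale0r subr0 fE (nilP s0) big_nil derivZ derivC scaler0 oppr0.
Qed.

(** This is [p(-D) g] for the monic polynomial [p] with roots [s], built factor by factor to match
    [ustable_diffop]. *)
Fixpoint diffop s g :=
  if s is z :: s' then - (diffop s' g)^`() - z *: diffop s' g else g.

Lemma diffop_ustable s g : (forall z, z \in s -> Im z <= 0) -> ustable g ->
  diffop s g = 0 \/ ustable (diffop s g).
Proof.
move=> + st; elim: s => [|a s IH] h /=; first by right.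
have [|->|] := IH; first by move=> z zs; apply: h; rewrite inE zs orbT.
  by left; rewrite deriv0 scaler0 subr0 oppr0.
by apply: ustable_diffop; apply: h; rewrite mem_head.
Qed.

Lemma diffopE s g N : (size s < N)%N ->
  diffop s g =
  \sum_(k < N) ((\prod_(z <- s) ('X - z%:P))`_k * (-1) ^+ k) *: g^`(k).
Proof.
elim: s N => [|a s IH] [|N] //= hN.
  rewrite big_ord_recl big_nil coef1 expr0 mulr1 scale1r derivn0.
  by rewrite big1 ?addr0 // => i _; rewrite coef1 mul0r scale0r.
set p := \prod_(z <- s) _ in IH.
(* The derivative shifts the index by one, so its sum is taken with [N] terms and the other one with
   [N.+1]. *)
rewrite {1}(IH N) // (IH N.+1); last exact: ltnW.
rewrite big_cons -/p mulrBl [RHS](eq_bigr (fun k : 'I_N.+1 =>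
  (('X * p)`_k * (-1) ^+ k) *: g^`(k) - a *: ((p`_k * (-1) ^+ k) *: g^`(k)))); last first.
  by move=> i _; rewrite coefB coefCM mulrBl scalerBl scalerA mulrA.
rewrite sumrB -scaler_sumr; congr (_ - _).
rewrite big_ord_recl coefXM eqxx mul0r scale0r add0r.
rewrite raddf_sum /= -sumrN; apply: eq_bigr => i _.
change (- ((p`_i * (-1) ^+ i) *: g^`(i))^`() =
  (('X * p)`_i.+1 * (-1) ^+ i.+1) *: (g^`(i))^`()).
by rewrite derivZ coefXM /= exprS mulN1r mulrN scaleNr.
Qed.

Definition umult (b : nat) f : {poly C} := \poly_(k < size f) (f`_k *+ b ^_ k).

Lemma coef_umult b f k : (umult b f)`_k = f`_k *+ b ^_ k.
Proof. by rewrite coef_poly; case: ltnP => // h; rewrite nth_default // mul0rn. Qed.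

(* [umult b f] is, up to sign, the reversal of [f(-D) X^b]. *)
Lemma umult_ustable b f : (forall t : C, 0 < Im t \/ t = 0 -> f.[t] != 0) ->
  forall t : C, 0 < Im t \/ t = 0 -> (umult b f).[t] != 0.
Proof.
move=> st; have f0 : f.[0] != 0 by apply: st; right.
move=> t [ht|->]; last first.
  by rewrite horner_coef0 coef_umult ffactn0 mulr1n -horner_coef0.
have [|c [s [c0 fE hs]]] := @ustable_factor f; first by move=> u hu; apply: st; left.
have t0 : t != 0 by apply: contraTneq ht => ->; rewrite ltxx.
(* Reversal corresponds to [t |-> - 1 / t], which preserves the upper half-plane. *)
pose u := - t^-1.
have hu : 0 < Im u by rewrite Im_opp oppr_gt0 Im_inv_lt0.
have stX : ustable ('X^b : {poly C}).
  move=> w hw; rewrite hornerXn expf_neq0 //.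
  by apply: contraTneq hw => ->; rewrite ltxx.
have szf : size f = (size s).+1 by rewrite fE size_scale // size_prod_XsubC.
have E : c *: diffop s 'X^b =
    \sum_(k < size f) (f`_k * (-1) ^+ k) *: ('X^(b - k) *+ b ^_ k).
  rewrite (@diffopE _ _ (size f)) ?szf // scaler_sumr; apply: eq_bigr => i _.
  by rewrite derivnXn [in RHS]fE coefZ scalerA mulrA.
(* The coefficient at [X^b] is [f.[0]]; this excludes the zero alternative of [diffop_ustable]. *)
have D0 : c *: diffop s 'X^b != 0.
  apply: contraNneq f0 => /(congr1 (fun p : {poly C} => p`_b)).
  rewrite E coef0 coef_sum szf big_ord_recl /= subn0 expr0 mulr1 ffactn0.
  rewrite coefZ coefXn eqxx mulr1 big1 ?addr0 ?horner_coef0 => [->//|i _].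
  (* Subtraction is truncated, so a later term can also have exponent [b], but only for [b = 0],
     where its falling factorial vanishes. *)
  rewrite /bump leq0n add1n coefZ coefMn coefXn; case: eqP => [bE|_]; last by rewrite mul0rn mulr0.
  have -> : b = 0%N by move: bE; case: b {E stX} => // b; rewrite subSS => bE;
    have := leq_subr i b; rewrite -bE ltnn.
  by rewrite ffact0n mulr0n mulr0.
have [D0'|Dst] := diffop_ustable hs stX; first by rewrite D0' scaler0 eqxx in D0.
suff -> : (umult b f).[t] = (-1) ^+ b * t ^+ b * (c *: diffop s 'X^b).[u].
  by rewrite hornerZ !mulf_neq0 ?expf_neq0 ?oppr_eq0 ?oner_eq0 ?Dst.
rewrite E horner_sum mulr_sumr horner_poly; apply: eq_bigr => i _.
rewrite hornerZ hornerMn hornerXn /u.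
have [ib|bi] := leqP i b; last by rewrite ffact_small // !mulr0n !mul0r !mulr0.
have eb (x : C) : x ^+ b = x ^+ i * x ^+ (b - i) by rewrite -exprD subnKC.
rewrite (exprNn t^-1) exprVn !eb -[f`_i *+ _]mulr_natl -[_ / _ *+ _]mulr_natl.
have -> : (-1) ^+ i * (-1) ^+ (b - i) * (t ^+ i * t ^+ (b - i)) *
  (f`_i * (-1) ^+ i * ((b ^_ i)%:R * ((-1) ^+ (b - i) / t ^+ (b - i)))) =
  ((-1) ^+ i * (-1) ^+ i) * ((-1) ^+ (b - i) * (-1) ^+ (b - i)) *
  (t ^+ (b - i) * (t ^+ (b - i))^-1) * ((b ^_ i)%:R * f`_i * t ^+ i).
  by ring.
by rewrite -!expr2 !sqrr_sign !mul1r divff ?expf_neq0 // mul1r.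
Qed.

End Univariate.

(** * Szasz, Cauchy and Remez inequalities *)

Section Szasz.
Variable R : realType.
Local Notation C := R[i].
Implicit Types (p q f g : {poly C}) (s : seq C).
Notation expR := (@sequences.expR R).

(** Each factor satisfies [|1 + z t|^2 = 1 + 2 Re (t z) + |t z|^2], and [1 + x <= expR x]. *)
Lemma szasz_prod s (t : C) : nc (\prod_(z <- s) (1 + z *: 'X)).[t] ^+ 2 <=
  expR (2 * Re (t * \sum_(z <- s) z) + nc t ^+ 2 * \sum_(z <- s) nc z ^+ 2).
Proof.
elim: s => [|z s IH].
  by rewrite !big_nil hornerC Normc.normc1 expr1n mulr0 /= !mulr0 addr0 exp.expR0.
rewrite !big_cons hornerM ncM exprMn mulrDr Re_add.
have -> (a b c d : R) : 2 * (a + b) + c * (nc z ^+ 2 + d) =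
  (2 * a + c * nc z ^+ 2) + (2 * b + c * d) by ring.
rewrite exp.expRD ler_pM ?sqr_ge0 //; apply: le_trans (exp.expR_ge1Dx _).
rewrite hornerD hornerC hornerZ hornerX -exprMn -ncM nc_sqr [in leRHS]nc_sqr !Re_add !Im_add /= add0r.
by rewrite (mulrC z); nra.
Qed.

(** The last equality is Newton's identity for the power sum of degree 2. *)
Lemma coef_prod_lin s : let p := \prod_(z <- s) (1 + z *: 'X) in
  [/\ p`_0 = 1, p`_1 = \sum_(z <- s) z &
      p`_1 ^+ 2 - 2 * p`_2 = \sum_(z <- s) z ^+ 2].
Proof.
elim: s => [|z s [IH0 IH1 IH2]] /=; first by rewrite !big_nil !coef1 expr0n mulr0 subr0.
rewrite !big_cons mulrDl mul1r -scalerAl !coefD !coefZ !coefXM /= IH0 -IH2 IH1.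
by split; [ring|ring|rewrite -IH1; ring].
Qed.

(** Write [|z|^2 = Re (z^2) + 2 (Im z)^2]. Newton's identity bounds the sum of the first terms; as
    all [Im z] have the same sign, the sum of their squares is at most the square of their sum,
    hence at most the squared modulus of the first coefficient. *)
Lemma sum_nc_sqr s : (forall z, z \in s -> Im z <= 0) ->
  let p : {poly C} := \prod_(z <- s) (1 + z *: 'X) in
  \sum_(z <- s) nc z ^+ 2 <= 3 * nc p`_1 ^+ 2 + 2 * nc p`_2.
Proof.
move=> hs /=; set p := \prod_(z <- s) _; have [p0 p1 p2] := coef_prod_lin s.
have -> : \sum_(z <- s) nc z ^+ 2 =
    Re (\sum_(z <- s) z ^+ 2) + 2 * \sum_(z <- s) Im z ^+ 2.
  rewrite Re_sum mulr_sumr -big_split; apply: eq_bigr => z _ /=.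
  by rewrite nc_sqr expr2 Re_mul; ring.
have hI : \sum_(z <- s) Im z ^+ 2 <= (\sum_(z <- s) Im z) ^+ 2 /\ \sum_(z <- s) Im z <= 0.
  elim: s hs {p p0 p1 p2} => [|z s IH] hs; first by rewrite !big_nil expr0n.
  have [|h1 h2] := IH; first by move=> y ys; apply: hs; rewrite inE ys orbT.
  by rewrite !big_cons; have := hs z (mem_head _ _); split; nra.
have h1 := nc_Im p`_1; have h2 := nc_Re (\sum_(z <- s) z ^+ 2).
rewrite {1}p1 Im_sum in h1; rewrite -{2}p2 in h2.
have h3 := ncB (p`_1 ^+ 2) (2 * p`_2); rewrite ncX ncM nc_nat in h3.
have h4 := le_trans h2 h3; rewrite -/p in h4 h1 *.
have h5 : (\sum_(z <- s) Im z) ^+ 2 <= nc p`_1 ^+ 2.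
  by rewrite -real_normK ?num_real // ler_pXn2r ?nnegrE ?nc_ge0.
by have := ler_norm (Re (\sum_(z <- s) z ^+ 2)); case: hI; lra.
Qed.

Lemma poly_factor1 f : f`_0 != 0 -> exists2 s,
  f = f`_0 *: \prod_(z <- s) (1 + z *: 'X) &
  forall z, z \in s -> exists2 r, z = - r^-1 & root f r /\ r != 0.
Proof.
move=> f0; have fn0 : f != 0 by apply: contraNneq f0 => ->; rewrite coef0.
have [c [s [c0 fE rs]]] := poly_factor fn0.
have rn0 r : root f r -> r != 0.
  by apply: contraTneq => ->; rewrite /root horner_coef0.
exists [seq - r^-1 | r <- s]; last first.
  by move=> z /mapP[r rin ->]; exists r => //; split; [|apply: rn0]; exact: rs.
have E : f = (c * \prod_(r <- s) (- r)) *: \prod_(z <- [seq - r^-1 | r <- s]) (1 + z *: 'X).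
  rewrite {1}fE -scalerA; congr (_ *: _).
  rewrite big_map -mul_polyC (big_morph _ (@polyCM _) (erefl _)) -big_split /=.
  apply: eq_big_seq => r rin; rewrite mulrDr mulr1 -scalerAr.
  by rewrite mul_polyC scalerA mulrNN mulVf ?rn0 ?rs // scale1r addrC polyCN.
rewrite {1}E; congr (_ *: _); rewrite [in RHS]E coefZ.
by have [-> _ _] := coef_prod_lin [seq - r^-1 | r <- s]; rewrite mulr1.
Qed.

(** After division by the constant term, [f] is a product of factors [1 + z X] with [Im z <= 0],
    whose coefficients of degree 1 and 2 are at most [M / d]; [szasz_prod] and [sum_nc_sqr] then
    apply. *)
Lemma szasz f (d M r : R) (t : C) : ustable f -> 0 < d -> d <= nc f`_0 ->
  nc f`_0 <= M -> nc f`_1 <= M -> nc f`_2 <= M -> nc t <= r ->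
  nc f.[t] <= M * expR (r * (M / d) + r ^+ 2 * (3 * (M / d) ^+ 2 + 2 * (M / d))).
Proof.
move=> st d0 hd h0 h1 h2 ht.
have f0 : f`_0 != 0 by rewrite -nc_gt0 (lt_le_trans d0).
have [s fE hs] := poly_factor1 f0.
have hIm z : z \in s -> Im z <= 0.
  case/hs => w -> [/rootP rw w0]; rewrite Im_opp oppr_le0; apply: Im_inv_ge0.
  by rewrite leNgt; apply/negP => /st; rewrite rw eqxx.
set p := \prod_(z <- s) _ in fE.
have M0 : 0 <= M by apply: le_trans h1; exact: nc_ge0.
have Md0 : 0 <= M / d by rewrite divr_ge0 // ltW.
have r0 : 0 <= r by apply: le_trans ht; exact: nc_ge0.
have [p0 p1 p2] := coef_prod_lin s.
have bd k : nc f`_k <= M -> nc p`_k <= M / d.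
  rewrite fE coefZ ncM => h; rewrite ler_pdivlMr // mulrC; apply: le_trans h.
  by rewrite ler_wpM2r // nc_ge0.
have hp1 := bd 1%N h1; have hp2 := bd 2%N h2.
move: (M / d) Md0 hp1 hp2 => A A0 hp1 hp2 {bd}.
have hq : 0 <= 3 * A ^+ 2 + 2 * A by rewrite addr_ge0 ?mulr_ge0 ?sqr_ge0.
set E := _ + _.
have hE : 1 <= expR E.
  apply: le_trans (exp.expR_ge1Dx _); rewrite lerDl /E.
  by rewrite addr_ge0 ?mulr_ge0 ?sqr_ge0.
have hE0 : 0 <= expR E := ltW (exp.expR_gt0 E).
rewrite fE hornerZ ncM ler_pM ?nc_ge0 //.
rewrite -(@ler_pXn2r _ 2) ?nnegrE ?nc_ge0 //.
apply: le_trans (szasz_prod s t) _.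
rewrite [leRHS]expr2 -exp.expRD exp.ler_expR -p1 -/p.
have h3 := sum_nc_sqr hIm; rewrite -/p /= in h3.
have h4 : Re (t * p`_1) <= r * A.
  apply: le_trans (ler_norm _) _; apply: le_trans (nc_Re _) _.
  by rewrite ncM ler_pM ?nc_ge0.
have h5 : \sum_(z <- s) nc z ^+ 2 <= 3 * A ^+ 2 + 2 * A.
  apply: le_trans h3 _; rewrite lerD ?ler_wpM2l // ler_pXn2r ?nnegrE ?nc_ge0 //.
have h6 : nc t ^+ 2 * \sum_(z <- s) nc z ^+ 2 <= r ^+ 2 * (3 * A ^+ 2 + 2 * A).
  rewrite ler_pM ?sqr_ge0 ?sumr_ge0 // ?ler_pXn2r ?nnegrE ?nc_ge0 // => z _.
  exact: sqr_ge0.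
have h7 : 0 <= r ^+ 2 * (3 * A ^+ 2 + 2 * A).
  by rewrite mulr_ge0 ?sqr_ge0.
by rewrite /E; lra.
Qed.

Lemma prim_root_ex n : (0 < n)%N -> exists z : C, n.-primitive_root z.
Proof.
move=> n0; pose p : {poly C} := 'X^n - 1.
have [r Dp] := closed_field_poly_normal p.
rewrite (monicP _) ?monicXnsubC // scale1r in Dp.
have rn1 : all n.-unity_root r by apply/allP=> z; rewrite -root_prod_XsubC -Dp.
have szr : (n < (size r).+1)%N by rewrite -(size_prod_XsubC r id) -Dp size_XnsubC.
have [|z _ hz] := hasP (has_prim_root n0 rn1 _ szr); last by exists z.
by rewrite -separable_prod_XsubC -Dp cyclotomic.separable_Xn_sub_1 // pnatr_eq0 -lt0n.
Qed.

Lemma nc_prim_root n (z : C) : n.-primitive_root z -> nc z = 1.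
Proof.
move=> pz; have n0 := prim_order_gt0 pz.
apply/eqP; rewrite -(@pexpr_eq1 _ _ n) ?nc_ge0 //.
by rewrite -ncX prim_expr_order // Normc.normc1.
Qed.

(** This discrete orthogonality takes the place of contour integrals in Cauchy's estimates below. *)
Lemma prim_root_orthogonal n (z : C) (a b : nat) : n.-primitive_root z ->
  (a < n)%N -> (b < n)%N ->
  \sum_(k < n) (z ^+ k) ^+ a * ((z ^+ k) ^+ b)^-1 = n%:R * (a == b)%:R.
Proof.
move=> pz an bn; have n0 := prim_order_gt0 pz.
have z0 : z != 0 by rewrite -nc_gt0 (nc_prim_root pz).
pose w := z ^+ a / z ^+ b.
rewrite (eq_bigr (fun k : 'I_n => w ^+ k)) => [|k _]; last first.
  by rewrite /w exprMn exprVn -!exprM ![(k * _)%N]mulnC.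
have [ab|ab] := eqVneq a b.
  rewrite mulr1 /w ab divff ?expf_neq0 // (eq_bigr (fun=> 1)) => [|k _]; last exact: expr1n.
  by rewrite sumr_const card_ord.
have w1 : w - 1 != 0.
  rewrite subr_eq0; apply: contraNneq ab => w1.
  have : z ^+ a == z ^+ b.
    by rewrite -[z ^+ a](divfK (expf_neq0 b z0)) -/w w1 mul1r.
  by rewrite (eq_prim_root_expr pz) !modn_small.
rewrite mulr0; apply: (mulfI w1); rewrite -subrX1 mulr0 /w exprMn exprVn -!exprM.
by rewrite ![(_ * n)%N]mulnC !exprM !(prim_expr_order pz) !expr1n invr1 mulr1 subrr.
Qed.

Lemma cauchy_poly f (r B : R) j : 0 <= r ->
  (forall t, nc t <= r -> nc f.[t] <= B) -> nc f`_j * r ^+ j <= B.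
Proof.
(* With [n] above both [j] and the degree, no other coefficient is aliased to [j], so the average
   over [n]-th roots of unity is exact. *)
move=> r0 hB; pose n := (maxn (size f) j.+1).
have n0 : (0 < n)%N by rewrite leq_max orbT.
have jn : (j < n)%N by rewrite leq_max leqnn orbT.
have [z pz] := prim_root_ex n0.
pose t k := r%:C%C * z ^+ k.
have E : \sum_(k < n) f.[t k] * ((z ^+ k) ^+ j)^-1 = n%:R * (f`_j * (r ^+ j)%:C%C).
  rewrite (eq_bigr (fun k : 'I_n => \sum_(i < n)
    f`_i * (r%:C%C) ^+ i * ((z ^+ k) ^+ i * ((z ^+ k) ^+ j)^-1))); last first.
    move=> k _; rewrite (@horner_coef_wide _ n) ?leq_maxl // mulr_suml.
    by apply: eq_bigr => i _; rewrite /t exprMn !mulrA.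
  rewrite exchange_big (bigD1 (Ordinal jn)) //= [X in _ + X]big1 => [|i ij].
    rewrite -mulr_sumr (prim_root_orthogonal pz) // eqxx mulr1 addr0 rmorphXn.
    by rewrite mulrC.
  rewrite -mulr_sumr (prim_root_orthogonal pz) // (_ : (i : nat) == j = false) ?mulr0 //.
  by apply: negbTE; apply: contraNneq ij => ij; apply/eqP/val_inj.
have : nc (n%:R * (f`_j * (r ^+ j)%:C%C)) <= n%:R * B.
  rewrite -E; apply: le_trans (nc_sum _ _ _) _.
  rewrite mulr_natl -[X in _ *+ X]card_ord -sumr_const; apply: ler_sum => k _.
  rewrite ncM ncV !ncX (nc_prim_root pz) !expr1n invr1 mulr1; apply: hB.
  by rewrite /t ncM ncX (nc_prim_root pz) expr1n mulr1 nc_real ger0_norm.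
rewrite ncM nc_nat ler_pM2l ?ltr0n // ncM nc_real ger0_norm //.
exact: exprn_ge0.
Qed.

End Szasz.

(** * Lagrange interpolation at equidistant nodes and a Remez inequality *)

Section Lagrange.
Variable R : realType.
Local Notation C := R[i].
Implicit Types (p q f g : {poly C}).

Lemma leq_bin_exp2 n m : ('C(n, m) <= 2 ^ n)%N.
Proof.
elim: n m => [|n IH] [|m]; rewrite ?bin0 ?expn_gt0 ?bin0n //.
by rewrite binS expnS mul2n -addnn leq_add.
Qed.

(** An elementary substitute for Stirling's formula: every factor of [(2 d)^_d = C(2 d, d) d!] is at
    least [d]. *)
Lemma leq_expn_fact d : (d ^ d <= 4 ^ d * d`!)%N.
Proof.
have : (d ^ d <= (d + d) ^_ d)%N.
  rewrite ffact_prod -[X in (d ^ X <= _)%N]card_ord -prod_nat_const.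
  by apply: leq_prod => i _; rewrite -addnBA ?leq_addr // ltnW.
move/leq_trans; apply; rewrite -bin_ffact leq_mul2r; apply/orP; right.
by apply: leq_trans (leq_bin_exp2 _ _) _; rewrite addnn -mul2n expnM.
Qed.

(** The sum of the two truncated differences is the distance of [l] and [j]; up to scaling, this is
    the denominator in Lagrange's formula at equidistant nodes. *)
Lemma prod_distn l d : (l <= d)%N ->
  (\prod_(0 <= j < d.+1 | j != l) ((l - j) + (j - l)) = l`! * (d - l)`!)%N.
Proof.
move=> ld; rewrite (@big_cat_nat _ _ _ l) //=; last exact: leqW.
rewrite [X in (_ * X)%N]big_ltn_cond ?ltnS // eqxx /=; congr (_ * _)%N.
  rewrite -ffactnn ffact_prod big_nat_cond -(big_mkord predT (fun i => l - i)%N) [RHS]big_nat_cond.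
  apply: eq_big => j; first by rewrite andbT andb_idr // => /andP[_]; rewrite ltn_neqAle => /andP[].
  case/andP=> /andP[_ jl] _; have /eqP-> : (j - l == 0)%N by rewrite subn_eq0 ltnW.
  by rewrite addn0.
rewrite fact_prod -(add1n l) big_addn subSn // big_nat_cond [RHS]big_nat_cond.
apply: eq_big => j.
  rewrite andbT andb_idr // => /andP[j1 _].
  by rewrite -{2}[l]add0n eqn_add2r -lt0n.
by move=> _; rewrite addnK subnDA subnAC subnn sub0n add0n.
Qed.

Lemma size_prod_XsubC_le (I : finType) (P : pred I) (x : I -> C) :
  (size (\prod_(i | P i) ('X - (x i)%:P))%R <= #|P|.+1)%N.
Proof.
rewrite -big_filter size_prod_XsubC ltnS cardE /enum_mem.
by rewrite size_filter; apply: eq_leq; apply: eq_count.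
Qed.

Lemma lagrange_interp (d : nat) (x : nat -> C) f : injective x -> (size f <= d.+1)%N ->
  f = \sum_(l < d.+1) (f.[x l] / \prod_(j < d.+1 | j != l) (x l - x j)) *:
      \prod_(j < d.+1 | j != l) ('X - (x j)%:P).
Proof.
move=> xI szf; set g := \sum_(l < d.+1) _; apply/eqP; rewrite -subr_eq0.
apply/negPn/negP => nz.
have /(max_poly_roots nz) : all (root (f - g)) [seq x i | i <- iota 0 d.+1].
  apply/allP => y /mapP[k]; rewrite mem_iota add0n => /andP[_ kd] ->.
  rewrite /root hornerD hornerN subr_eq0 /g horner_sum (bigD1 (Ordinal kd)) //=.
  rewrite [X in _ + X]big1 ?addr0 => [|i ik].
    rewrite hornerZ horner_prod.
    under [X in _ * X]eq_bigr do rewrite hornerXsubC.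
    by rewrite divfK //; apply/prodf_neq0 => j jk; rewrite subr_eq0 (inj_eq xI) eq_sym -val_eqE in jk *.
  rewrite hornerZ horner_prod [X in _ * X](bigD1 (Ordinal kd)) 1?eq_sym //= hornerXsubC subrr.
  by rewrite mul0r mulr0.
rewrite (map_inj_uniq xI) iota_uniq.
move=> /(_ isT); rewrite size_map size_iota ltnNge => /negP; apply.
apply: leq_trans (size_polyD _ _) _; rewrite geq_max szf size_polyN.
apply: leq_trans (size_sum _ _ _) _; apply/bigmax_leqP => l _.
apply: leq_trans (size_scale_leq _ _) _; apply: leq_trans (size_prod_XsubC_le _ _) _.
have c := cardC1 l; rewrite card_ord in c.
by rewrite ltnS; apply: eq_leq; rewrite -[RHS]c; apply: eq_card.
Qed.

Lemma fact_quot_le l d : (l <= d)%N -> (d ^ d <= 8 ^ d * (l`! * (d - l)`!))%N.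
Proof.
move=> ld; apply: leq_trans (leq_expn_fact d) _.
rewrite -(bin_fact ld) mulnA leq_mul2r; apply/orP; right.
by rewrite (expnMn 4 2) leq_mul2l leq_bin_exp2 orbT.
Qed.

(** Interpolate at the points [1 + l / d] of [[1, 2]]. Numerators are at most [(r + 2) ^ d],
    denominators at least [8 ^ -d], and there are [d + 1 <= 2 ^ d] terms: hence the constant 16. *)
Lemma remez f (d : nat) (M r : R) (t : C) : (size f <= d.+1)%N -> 0 <= r ->
  (forall x : R, 1 <= x <= 2 -> nc f.[x%:C%C] <= M) -> nc t <= r ->
  nc f.[t] <= M * (16 * (r + 2)) ^+ d.
Proof.
move=> szf r0 hM ht; have M0 : 0 <= M by apply: le_trans (hM 1 _); rewrite ?nc_ge0 //; lra.
(* Constants are treated apart, since the nodes involve division by [d]. *)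
case: d szf => [|d'] szf.
  rewrite expr0 mulr1; rewrite (size1_polyC szf) hornerC; have := hM 1.
  by rewrite {1}(size1_polyC szf) hornerC; apply; apply/andP; split; lra.
set d := d'.+1 in szf *; have d0 : 0 < d%:R :> R by rewrite ltr0n.
pose xr (l : nat) : R := 1 + l%:R / d%:R.
pose x l : C := (xr l)%:C%C.
have xI : injective x.
  move=> i j /complexI /addrI /(mulIf _) h; apply/eqP; rewrite -(@eqr_nat R).
  by apply/eqP/h; rewrite invr_eq0 gt_eqF.
have xr12 l : (l < d.+1)%N -> 1 <= xr l <= 2.
  move=> ld; rewrite /xr lerDl divr_ge0 //=.
  by rewrite (_ : 2 = 1 + 1 :> R) // lerD2l ler_pdivrMr // mul1r ler_nat.
rewrite (lagrange_interp xI szf) horner_sum; apply: le_trans (nc_sum _ _ _) _.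
apply: (@le_trans _ _ (\sum_(l < d.+1) M * (8 * (r + 2)) ^+ d)); last first.
  rewrite sumr_const card_ord -mulrnAr ler_wpM2l //.
  have -> : 16 * (r + 2) = 2 * (8 * (r + 2)) by ring.
  rewrite [leRHS]exprMn -[leLHS]mulr_natl ler_wpM2r ?exprn_ge0 ?mulr_ge0 ?addr_ge0 //.
  by rewrite -natrX ler_nat ltn_expl.
apply: ler_sum => l _; have ld : (l <= d)%N by rewrite -ltnS.
rewrite hornerZ !ncM ncV -mulrA; apply: ler_pM; rewrite ?nc_ge0 //.
- by rewrite mulr_ge0 ?invr_ge0 ?nc_ge0.
- by apply: hM; exact: xr12.
rewrite horner_prod !nc_prod.
have c1 : #|[pred j : 'I_d.+1 | j != l]| = d by have := cardC1 l; rewrite card_ord.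
have h1 : \prod_(j < d.+1 | j != l) nc ('X - (x j)%:P).[t] <= (r + 2) ^+ d.
  rewrite -[X in _ ^+ X]c1 -prodr_const; apply: ler_prod => j _.
  rewrite nc_ge0 hornerXsubC /=; apply: le_trans (ncB _ _) _; rewrite lerD //.
  rewrite nc_real ger0_norm; have /andP[h1 h2] := xr12 j (ltn_ord j); lra.
have h2 : \prod_(j < d.+1 | j != l) nc (x l - x j) = (l`! * (d - l)`!)%:R / d%:R ^+ d.
  rewrite -prod_distn // big_mkord natr_prod -[X in _ ^+ X]c1 -prodr_const -prodf_div.
  apply: eq_bigr => j _; rewrite /x -raddfB nc_real /xr opprD addrACA subrr add0r -mulrBl.
  rewrite normrM [X in _ * X]ger0_norm ?invr_ge0 ?ltW //; congr (_ / _).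
  have [jl|lj] := leqP j l.
    by rewrite -natrB // ger0_norm // (eqP jl) addn0.
  by rewrite distrC -natrB ?(ltnW lj) // ger0_norm // (eqP (ltnW lj)).
rewrite h2 invf_div exprMn; apply: ler_pM => //.
- by rewrite divr_ge0 // exprn_ge0 // ltW.
- by apply: prodr_ge0 => j _; exact: nc_ge0.
rewrite ler_pdivrMr ?ltr0n ?muln_gt0 ?fact_gt0 // -!natrX -natrM ler_nat.
exact: fact_quot_le.
Qed.

End Lagrange.

(** * Stable polynomials in several variables *)

Section Multivariate.
Variable R : realType.
Local Notation C := R[i].
Variable m : nat.
Implicit Types (p q : {mpoly C[m]}) (v u : 'I_m -> C) (mu nu : 'X_{1..m}).

Definition inH v := forall i, 0 < Im (v i).

(** In [stable] the imaginary part is an element of [R[i]], in [inH] one of [R]. *)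
Lemma stableP p : stable p <-> forall v, inH v -> p.@[v] != 0.
Proof.
by split=> st v hv; apply: st => i; move: (hv i); rewrite -complexIm (ltcR 0).
Qed.

Definition mon mu v : C := \prod_(i < m) v i ^+ mu i.

Lemma meval_wide k p v : (msize p <= k)%N ->
  p.@[v] = \sum_(mu : 'X_{1..m < k}) p@_mu * mon mu v.
Proof. by move=> h; rewrite [LHS](mmapE k h). Qed.

Lemma msize_leP p k : (forall mu, p@_mu != 0 -> (mdeg mu < k)%N) -> (msize p <= k)%N.
Proof.
move=> h; rewrite msizeE; apply/bigmax_leqP_seq => mu hmu _.
by apply: h; rewrite -mcoeff_msupp.
Qed.

Lemma nc_mon_le mu v (r : R) : (forall i, nc (v i) <= r) -> nc (mon mu v) <= r ^+ mdeg mu.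
Proof.
move=> hv; rewrite nc_prod mdegE -prodrXr; apply: ler_prod => i _.
have r0 : 0 <= r := le_trans (nc_ge0 _) (hv i).
by rewrite nc_ge0 ncX lerXn2r ?nnegrE ?nc_ge0.
Qed.

Lemma mon_scale (t : C) mu v : mon mu (fun i => t * v i) = t ^+ mdeg mu * mon mu v.
Proof.
by rewrite /mon mdegE -prodrXr -big_split; apply: eq_bigr => i _; rewrite exprMn.
Qed.

Definition mmult (L : 'X_{1..m} -> C) p : {mpoly C[m]} :=
  \sum_(mu <- msupp p) (L mu * p@_mu) *: 'X_[mu].

Lemma mcoeff_mmult L p mu : (mmult L p)@_mu = L mu * p@_mu.
Proof.
rewrite /mmult raddf_sum /=.
have [h|h] := boolP (mu \in msupp p).
  rewrite (bigD1_seq mu) ?msupp_uniq //= mcoeffZ mcoeffX eqxx mulr1 big1 ?addr0 // => nu.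
  by move=> /negbTE nh; rewrite mcoeffZ mcoeffX nh mulr0.
rewrite (memN_msupp_eq0 h) mulr0 big1_seq // => nu /andP[_ hn].
rewrite mcoeffZ mcoeffX; case: eqP hn h => [-> ->//|_ _ _]; exact: mulr0.
Qed.

Lemma mmult_comp L1 L2 p : mmult L1 (mmult L2 p) = mmult (fun mu => L1 mu * L2 mu) p.
Proof. by apply/mpolyP => mu; rewrite !mcoeff_mmult mulrA. Qed.

Lemma msize_mmult L p : (msize (mmult L p) <= msize p)%N.
Proof.
apply: msize_leP => mu; rewrite mcoeff_mmult mulf_eq0 negb_or -mcoeff_msupp.
by case/andP=> _; exact: msize_mdeg_lt.
Qed.

Lemma meval_mmult L p v :
  (mmult L p).@[v] = \sum_(mu : 'X_{1..m < msize p}) L mu * p@_mu * mon mu v.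
Proof.
rewrite (meval_wide _ (msize_mmult L p)).
by apply: eq_bigr => mu _; rewrite mcoeff_mmult.
Qed.

Lemma meval_mmult_mon p u v :
  (mmult (fun mu => mon mu u) p).@[v] = p.@[fun i => u i * v i].
Proof.
rewrite meval_mmult (meval_wide _ (leqnn _)); apply: eq_bigr => mu _.
rewrite -mulrA mulrCA; congr (_ * _).
by rewrite /mon -big_split; apply: eq_bigr => i _; rewrite exprMn.
Qed.

(** Average over all [m]-tuples of [n]-th roots of unity; the sum factors into one orthogonality
    relation per variable. *)
Lemma cauchy_mpoly p (r B : R) nu : 0 <= r ->
  (forall v, (forall i, nc (v i) <= r) -> nc p.@[v] <= B) ->
  nc p@_nu * r ^+ mdeg nu <= B.
Proof.
move=> r0 hB; pose k := maxn (msize p) (mdeg nu).+1; pose n := k.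
have kn : (mdeg nu < k)%N by rewrite leq_max leqnn orbT.
have n0 : (0 < n)%N by apply: leq_trans kn.
have lt_mon (mu : 'X_{1..m}) i : (mdeg mu < k)%N -> (mu i < n)%N.
  by move=> h; apply: leq_trans h; rewrite ltnS mdegE (bigD1 i) //= leq_addr.
have [z pz] := prim_root_ex R n0.
pose t (f : {ffun 'I_m -> 'I_n}) i : C := r%:C%C * z ^+ f i.
pose w (f : {ffun 'I_m -> 'I_n}) : C := \prod_(i < m) ((z ^+ f i) ^+ nu i)^-1.
have E : \sum_f p.@[t f] * w f = n%:R ^+ m * (p@_nu * (r ^+ mdeg nu)%:C%C).
  rewrite (eq_bigr (fun f : {ffun 'I_m -> 'I_n} => \sum_(mu : 'X_{1..m < k}) p@_mu * (r%:C%C) ^+ mdeg mu *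
    \prod_i ((z ^+ f i) ^+ mu i * ((z ^+ f i) ^+ nu i)^-1))); last first.
    move=> f _; rewrite (@meval_wide k) ?leq_maxl // mulr_suml.
    apply: eq_bigr => mu _; rewrite /t mon_scale -!mulrA; congr (_ * (_ * _)).
    by rewrite /w -big_split.
  rewrite exchange_big (bigD1 (BMultinom kn)) //= [X in _ + X]big1 => [|mu hmu].
    rewrite -mulr_sumr -(bigA_distr_bigA (fun i (j : 'I_n) =>
      (z ^+ j) ^+ nu i * ((z ^+ j) ^+ nu i)^-1)) /=.
    rewrite (eq_bigr (fun=> n%:R)) => [|i _]; last first.
      by rewrite (prim_root_orthogonal pz) ?lt_mon // eqxx mulr1.
    by rewrite prodr_const card_ord addr0 rmorphXn mulrC.
  rewrite -mulr_sumr -(bigA_distr_bigA (fun i (j : 'I_n) =>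
      (z ^+ j) ^+ mu i * ((z ^+ j) ^+ nu i)^-1)) /=.
  have [i hi] : exists i, mu i != nu i.
    apply/existsP; rewrite -negb_forall; apply: contra hmu => /forallP h.
    by apply/eqP/val_inj/mnmP => i; apply/eqP/h.
  rewrite (bigD1 i) //= (prim_root_orthogonal pz) ?lt_mon ?bmdeg //.
  by rewrite (negbTE hi) mulr0 mul0r mulr0.
have ncw f : nc (w f) = 1.
  rewrite nc_prod big1 // => i _.
  by rewrite ncV !ncX (nc_prim_root pz) !expr1n invr1.
have : nc (n%:R ^+ m * (p@_nu * (r ^+ mdeg nu)%:C%C)) <= n%:R ^+ m * B.
  rewrite -E; apply: le_trans (nc_sum _ _ _) _.
  apply: (@le_trans _ _ (\sum_(f : {ffun 'I_m -> 'I_n}) B)).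
    apply: ler_sum => f _; rewrite ncM ncw mulr1; apply: hB => i.
    by rewrite /t ncM ncX (nc_prim_root pz) expr1n mulr1 nc_real ger0_norm.
  by rewrite sumr_const card_ffun !card_ord -natrX mulr_natl.
rewrite ncM ncX nc_nat ler_pM2l ?exprn_gt0 ?ltr0n // ncM nc_real ger0_norm //.
exact: exprn_ge0.
Qed.

(** A polynomial vanishing everywhere satisfies Cauchy's estimate with [B = 0]. *)
Lemma mpoly_neq0_meval p : p != 0 -> exists v, p.@[v] != 0.
Proof.
move=> p0; apply: boolp.contrapT => h; move/negP: p0; apply; apply/eqP/mpolyP => nu.
rewrite mcoeff0; apply/eqP; rewrite -nc_eq0 eq_le nc_ge0 andbT.
have := @cauchy_mpoly p 1 0 nu ler01; rewrite expr1n mulr1; apply=> v _.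
by case: (eqVneq p.@[v] 0) => [->|hv]; [rewrite Normc.normc0|case: h; exists v].
Qed.

Definition line p v u : {poly C} :=
  mmap (@polyC C) (fun i => (v i)%:P + u i *: 'X) p.

Lemma horner_line p v u t : (line p v u).[t] = p.@[fun i => v i + t * u i].
Proof.
rewrite /line /mmap horner_sum mevalE; apply: eq_bigr => mu _.
rewrite hornerM hornerC; congr (_ * _); rewrite /mmap1 horner_prod.
by apply: eq_bigr => i _; rewrite horner_exp hornerD hornerC hornerZ hornerX [t * _]mulrC.
Qed.

Lemma size_line p v u : (size (line p v u) <= msize p)%N.
Proof.
rewrite /line /mmap; apply: leq_trans (size_sum _ _ _) _.
apply/bigmax_leqP_seq => mu hmu _; rewrite mul_polyC.
apply: leq_trans (size_scale_leq _ _) _.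
apply: leq_trans (msize_mdeg_lt hmu); rewrite mdegE /mmap1.
elim/big_rec2: _ => [|i a q _ IH]; first by rewrite size_poly1.
apply: leq_trans (size_polyMleq _ _) _.
have h : (size (((v i)%:P + u i *: 'X) ^+ mu i) <= (mu i).+1)%N.
  apply: leq_trans (size_poly_exp_leq _ _) _.
  rewrite ltnS -[X in (_ <= X)%N]mul1n leq_mul2r; apply/orP; right.
  rewrite -subn1 leq_subLR.
  apply: leq_trans (size_polyD _ _) _; rewrite geq_max (leq_trans (size_polyC_leq1 _)) //=.
  by apply: leq_trans (size_scale_leq _ _) _; rewrite size_polyX.
by rewrite -subn1 leq_subLR add1n -addnS -addSn leq_add.
Qed.

(** All roots [r] have modulus at least [d], so each linear factor grows from 0 to 1 by at most
    [(|r| + 1) / |r| <= 1 + 1 / d]. *)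
Lemma harnack_poly (f : {poly C}) D (d : R) : 0 < d -> (size f <= D.+1)%N ->
  (forall t, nc t < d -> f.[t] != 0) -> nc f.[1] <= nc f.[0] * (1 + d^-1) ^+ D.
Proof.
move=> d0 szf st; have f0 : f != 0.
  by apply: contraNneq (st 0 _) => [->|]; rewrite ?horner0 // Normc.normc0.
have [c [s [c0 fE rs]]] := poly_factor f0.
have K1 : 1 <= 1 + d^-1 by rewrite lerDl invr_ge0 ltW.
have hs : (size s <= D)%N.
  by move: szf; rewrite fE size_scale // size_prod_XsubC.
apply: (@le_trans _ _ (nc f.[0] * (1 + d^-1) ^+ size s)); last first.
  by rewrite ler_wpM2l ?nc_ge0 // ler_weXn2l.
rewrite fE !hornerZ !horner_prod !ncM -mulrA ler_wpM2l ?nc_ge0 // !nc_prod.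
elim: s rs {hs fE} => [|r s IH] rs; first by rewrite !big_nil mul1r.
rewrite !big_cons exprS mulrACA ler_pM ?nc_ge0 ?prodr_ge0 //=.
- by move=> i _; exact: nc_ge0.
- rewrite !hornerXsubC sub0r ncN; apply: le_trans (ncB _ _) _.
  rewrite Normc.normc1 mulrDr mulr1 addrC lerD2l ler_pdivlMr // mul1r leNgt.
  by apply/negP => /st; rewrite (rootP (rs r _)) ?mem_head // eqxx.
- by apply: IH => z zs; apply: rs; rewrite inE zs orbT.
Qed.

(** On the complex line from [v] to [u] the parameters of modulus below [d] give points of the
    half-planes, where [p] has no zero. Only [v] has to lie there; [u] is arbitrary. *)
Lemma harnack p D v u (d : R) : stable p -> (msize p <= D.+1)%N -> inH v -> 0 < d ->
  (forall i, d * nc (u i - v i) <= Im (v i)) ->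
  nc p.@[u] <= nc p.@[v] * (1 + d^-1) ^+ D.
Proof.
move=> st szp hv d0 hd; pose f := line p v (fun i => u i - v i).
have -> : p.@[u] = f.[1].
  by rewrite horner_line; apply: meval_eq => i; rewrite mul1r addrC subrK.
have -> : p.@[v] = f.[0].
  by rewrite horner_line; apply: meval_eq => i; rewrite mul0r addr0.
apply: harnack_poly => //; first exact: leq_trans (size_line _ _ _) szp.
move=> t ht; rewrite horner_line; apply: (proj1 (stableP p) st) => i.
rewrite Im_add; have h := nc_Im (t * (u i - v i)); rewrite ncM in h.
have [->|ne] := eqVneq (u i - v i) 0; first by rewrite mulr0 /= addr0; exact: hv.
have : nc t * nc (u i - v i) < d * nc (u i - v i) by rewrite ltr_pM2r // nc_gt0.
by move: h (hd i); rewrite ler_norml => /andP[]; lra.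
Qed.

Lemma pos_ratio (I : finType) (a b : I -> R) : (forall i, 0 < a i) -> (forall i, 0 <= b i) ->
  exists2 d : R, 0 < d & forall i, d * b i <= a i.
Proof.
move=> a0 b0; have s0 : 0 <= \sum_i b i / a i.
  by apply: sumr_ge0 => i _; rewrite divr_ge0 // ltW.
have s1 : 0 < 1 + \sum_i b i / a i by rewrite ltr_pwDl.
exists (1 + \sum_i b i / a i)^-1 => [|i]; first by rewrite invr_gt0.
rewrite mulrC ler_pdivrMr // mulrC -ler_pdivrMr //.
rewrite (bigD1 i) //= [leRHS]addrCA lerDl addr_ge0 // sumr_ge0 // => j _.
by rewrite divr_ge0 // ltW.
Qed.

(* The bound on the degree makes the constant of [harnack] uniform in [q], so
   that convergence at two points is enough. *)
Lemma hurwitz D p :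
  (forall v u (e : R), 0 < e -> exists q, [/\ q = 0 \/ stable q, (msize q <= D.+1)%N,
     nc (q.@[v] - p.@[v]) <= e & nc (q.@[u] - p.@[u]) <= e]) ->
  p = 0 \/ stable p.
Proof.
move=> h; have [->|p0] := eqVneq p 0; [by left|right].
apply/stableP => v hv; apply/eqP => pv0.
have [u pu] := mpoly_neq0_meval p0.
have [d d0 hd] := pos_ratio hv (fun i => nc_ge0 (u i - v i)).
pose K := (1 + d^-1) ^+ D.
have K0 : 0 <= K by rewrite exprn_ge0 // addr_ge0 // invr_ge0 ltW.
have P0 : 0 < nc p.@[u] by rewrite nc_gt0.
(* With this tolerance Harnack's inequality for [q] forces [|p(u)| <= e (K + 1) = |p(u)| / 2]. *)
have e0 : 0 < nc p.@[u] / (2 * (K + 1)) by rewrite divr_gt0 // mulr_gt0 // ltr_wpDl.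
have [q [hq szq hqv hqu]] := h v u _ e0; set e := _ / _ in e0 hqv hqu.
have h1 : nc q.@[u] <= nc q.@[v] * K.
  by case: hq => [->|st]; [rewrite !meval0 Normc.normc0 mul0r|exact: harnack].
rewrite pv0 subr0 in hqv.
have h2 : nc p.@[u] <= e * (K + 1).
  have -> : p.@[u] = q.@[u] - (q.@[u] - p.@[u]) by rewrite opprB addrCA subrr addr0.
  apply: le_trans (ncB _ _) _; rewrite mulrDr mulr1 lerD // (le_trans h1) //.
  by rewrite ler_wpM2r.
have h3 : e * (K + 1) = nc p.@[u] / 2.
  by rewrite /e; field; apply: lt0r_neq0; rewrite ltr_wpDl.
by move: h2 P0; rewrite h3; move: (nc _) => a; clear; lra.
Qed.

End Multivariate.

(** * Falling factorial multipliers in several variables *)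

Section Multiplier.
Variable R : realType.
Local Notation C := R[i].
Variable m : nat.
Implicit Types (p q : {mpoly C[m]}) (v u : 'I_m -> C) (mu nu : 'X_{1..m}).

Lemma meval_coef_close k p q (e : R) v : (msize p <= k)%N -> (msize q <= k)%N ->
  (forall mu, nc (p@_mu - q@_mu) <= e) ->
  nc (p.@[v] - q.@[v]) <= e * \sum_(mu : 'X_{1..m < k}) nc (mon mu v).
Proof.
move=> sp sq h; rewrite (meval_wide _ sp) (meval_wide _ sq) -sumrB mulr_sumr.
apply: le_trans (nc_sum _ _ _) _; apply: ler_sum => mu _.
by rewrite -mulrBl ncM ler_wpM2r ?nc_ge0.
Qed.

Lemma hurwitz_coef D p : (msize p <= D.+1)%N ->
  (forall e : R, 0 < e -> exists q, [/\ q = 0 \/ stable q, (msize q <= D.+1)%N &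
     forall mu, nc (q@_mu - p@_mu) <= e]) ->
  p = 0 \/ stable p.
Proof.
move=> sp h; apply: (@hurwitz _ _ D) => v u e e0.
pose S (w : 'I_m -> C) : R := \sum_(mu : 'X_{1..m < D.+1}) nc (mon mu w).
have S0 w : 0 <= S w by apply: sumr_ge0 => mu _; exact: nc_ge0.
have K0 : 0 < S v + S u + 1 by rewrite ltr_wpDl ?addr_ge0.
have [q [hq sq cq]] := h (e / (S v + S u + 1)) (divr_gt0 e0 K0).
exists q; split=> //; apply: le_trans (meval_coef_close _ sq sp cq) _;
  rewrite mulrAC ler_pdivrMr // ler_pM2l // -/(S _).
  by have := S0 u; lra.
by have := S0 v; lra.
Qed.

Lemma meval_bounded p (r : R) : exists2 B, 0 <= B &
  forall v, (forall i, nc (v i) <= r) -> nc p.@[v] <= B.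
Proof.
exists (\sum_(mu <- msupp p) nc p@_mu * `|r| ^+ mdeg mu).
  by apply: sumr_ge0 => mu _; rewrite mulr_ge0 ?nc_ge0 // exprn_ge0.
move=> v hv; rewrite mevalE; apply: le_trans (nc_sum _ _ _) _.
apply: ler_sum => mu _; rewrite ncM ler_wpM2l ?nc_ge0 //.
by apply: nc_mon_le => i; apply: le_trans (ler_norm r); exact: hv.
Qed.

(** The property passes to sums and, with [meval_bounded], to products, so constants and variables
    suffice. *)
Lemma meval_lipschitz p (r : R) : exists2 L, 0 <= L &
  forall v u (e : R), 0 <= e -> (forall i, nc (v i) <= r) -> (forall i, nc (u i) <= r) ->
    (forall i, nc (v i - u i) <= e) -> nc (p.@[v] - p.@[u]) <= L * e.
Proof.
pose P p := exists2 L, 0 <= L & forall v u (e : R), 0 <= e ->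
  (forall i, nc (v i) <= r) -> (forall i, nc (u i) <= r) ->
    (forall i, nc (v i - u i) <= e) -> nc (p.@[v] - p.@[u]) <= L * e.
have PD p1 p2 : P p1 -> P p2 -> P (p1 + p2).
  move=> [L1 l1 h1] [L2 l2 h2]; exists (L1 + L2) => [|v u e e0 hv hu he].
    exact: addr_ge0.
  rewrite !mevalD opprD addrACA mulrDl; apply: le_trans (ncD _ _) _.
  by rewrite lerD ?h1 ?h2.
have PM p1 p2 : P p1 -> P p2 -> P (p1 * p2).
  move=> [L1 l1 h1] [L2 l2 h2].
  have [B1 b1 k1] := meval_bounded p1 r; have [B2 b2 k2] := meval_bounded p2 r.
  exists (L1 * B2 + B1 * L2) => [|v u e e0 hv hu he]; first by rewrite addr_ge0 ?mulr_ge0.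
  rewrite !mevalM.
  have -> (a b c d : C) : a * b - c * d = (a - c) * b + c * (b - d) by ring.
  apply: le_trans (ncD _ _) _; rewrite !ncM mulrDl; apply: lerD.
    by rewrite mulrAC ler_pM ?nc_ge0 ?h1 ?k2.
  by rewrite -mulrA ler_pM ?nc_ge0 ?h2 ?k1.
have PC c : P c%:MP.
  by exists 0 => // v u e _ _ _ _; rewrite !mevalC subrr mul0r Normc.normc0.
have PX i : P 'X_i.
  by exists 1 => // v u e _ _ _ he; rewrite !mevalXU mul1r.
rewrite -/(P p) (mpolyE p); apply: (big_ind P) => [|//|mu _]; first by rewrite -(mpolyC0); exact: PC.
rewrite -mul_mpolyC; apply: (PM) => //; rewrite mpolyXE_id.
apply: (big_ind P) => [| |i _]; [|exact: PM|]; first by rewrite -mpolyC1; exact: PC.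
elim: (mu i) => [|k IH]; first by rewrite expr0 -mpolyC1; exact: PC.
by rewrite exprS; exact: PM.
Qed.

(** The bound [k] is a parameter so that a polynomial and its image under a multiplier, whose sizes
    may differ, are cut at the same place in [umult_sec]. *)
Definition sec k p v (j : 'I_m) : {poly C} :=
  \sum_(mu : 'X_{1..m < k}) (p@_mu * \prod_(l < m | l != j) v l ^+ mu l) *: 'X^(mu j).

Lemma horner_sec k p v j t : (msize p <= k)%N ->
  (sec k p v j).[t] = p.@[fun l => if l == j then t else v l].
Proof.
move=> h; rewrite (meval_wide _ h) /sec horner_sum; apply: eq_bigr => mu _.
rewrite hornerZ hornerXn -mulrA; congr (_ * _); rewrite /mon [in RHS](bigD1 j) //= eqxx mulrC.
by congr (_ * _); apply: eq_bigr => l /negbTE ->.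
Qed.

Lemma umult_sec k p v j b :
  umult b (sec k p v j) = sec k (mmult (fun mu => (b ^_ (mu j))%:R) p) v j.
Proof.
apply/polyP => i; rewrite coef_umult !coef_sum -sumrMnl.
apply: eq_bigr => mu _; rewrite !coefZ coefXn mcoeff_mmult.
case: eqP => [->|_]; last by rewrite !mulr0 mul0rn.
by rewrite -[LHS]mulr_natl !mulrA.
Qed.

(** The several-variable form of the hypothesis of [umult_ustable]; fixing all but one coordinate
    preserves it, so the variables can be treated one after another. *)
Definition inH0 v := forall i, 0 < Im (v i) \/ v i = 0.
Definition stable0 p := forall v, inH0 v -> p.@[v] != 0.

Lemma mmult1_stable0 j b p : stable0 p -> stable0 (mmult (fun mu => (b ^_ (mu j))%:R) p).
Proof.
move=> st v hv; have h := @horner_sec (msize p) _ v j (v j) (msize_mmult _ p).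
have E : (fun l => if l == j then v j else v l) =1 v by move=> l; case: eqP => [->|].
rewrite -(meval_eq _ E) -h -umult_sec; apply: umult_ustable => // t ht.
by rewrite horner_sec //; apply: st => l; case: eqP.
Qed.

Lemma mmult_stable0 b p : stable0 p -> stable0 (mmult (fun mu => (ffact_mnm b mu)%:R) p).
Proof.
move=> st; rewrite /ffact_mnm.
suff h (s : seq 'I_m) : stable0 (mmult (fun mu => (\prod_(i <- s) (b i) ^_ (mu i))%N%:R) p).
  exact: h.
elim: s => [|j s IH].
  have -> : mmult (fun mu => (\prod_(i <- [::]) (b i) ^_ (mu i))%N%:R) p = p.
    by apply/mpolyP => mu; rewrite mcoeff_mmult big_nil mul1r.
  by [].
have -> : mmult (fun mu => (\prod_(i <- j :: s) (b i) ^_ (mu i))%N%:R) p =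
    mmult (fun mu => ((b j) ^_ (mu j))%:R)
      (mmult (fun mu => (\prod_(i <- s) (b i) ^_ (mu i))%N%:R) p).
  by apply/mpolyP => mu; rewrite mmult_comp !mcoeff_mmult big_cons natrM.
exact: mmult1_stable0.
Qed.

Definition shift (s : C) p := p \mPo [tuple 'X_i + s%:MP | i < m].

Lemma meval_shift s p v : (shift s p).@[v] = p.@[fun i => v i + s].
Proof.
rewrite comp_mpoly_meval; apply: meval_eq => i.
by rewrite tnth_mktuple mevalD mevalXU mevalC.
Qed.

Lemma ffact_mnm_eq0 b mu : (mdeg b < mdeg mu)%N -> ffact_mnm b mu = 0%N.
Proof.
move=> h; apply/eqP; apply: contraLR h => nz; rewrite -leqNgt !mdegE.
apply: leq_sum => i _; rewrite leqNgt; apply: contra nz => h.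
by rewrite /ffact_mnm (bigD1 i) //= ffact_small.
Qed.

Lemma msize_mmult_ffact b p :
  (msize (mmult (fun mu => (ffact_mnm b mu)%:R) p) <= (mdeg b).+1)%N.
Proof.
apply: msize_leP => mu; rewrite mcoeff_mmult ltnS; apply: contraR.
by rewrite -ltnNge => /ffact_mnm_eq0 ->; rewrite mul0r.
Qed.

(* Translating by [i e] makes [p] nonzero also where some coordinates vanish;
   there no one-variable section is annihilated, so no case distinction is
   needed before letting [e] tend to 0. *)
Lemma mmult_ffact_stable b p : stable p ->
  let q := mmult (fun mu => (ffact_mnm b mu)%:R) p in q = 0 \/ stable q.
Proof.
move=> st; apply: (@hurwitz_coef (mdeg b)); first exact: msize_mmult_ffact.
(* Radius 2, because points of the unit polydisc are translated by [s] with [|s| = t <= 1]. *)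
move=> e e0; have [L L0 hL] := meval_lipschitz p 2.
pose F : R := \sum_(mu : 'X_{1..m < (mdeg b).+1}) (ffact_mnm b mu)%:R.
have F0 : 0 <= F by apply: sumr_ge0.
have LF : 0 <= L * F by rewrite mulr_ge0.
pose t := Num.min 1 (e / (L * F + 1)).
have t0 : 0 < t by rewrite lt_min ltr01 divr_gt0 // ltr_wpDl.
have t1 : t <= 1 by rewrite ge_min lexx.
have te : L * t * F <= e.
  rewrite mulrAC; apply: (@le_trans _ _ ((L * F + 1) * t)); first by rewrite ler_pM2r // lerDl.
  by rewrite mulrC -ler_pdivlMr ?ltr_wpDl // ge_min lexx orbT.
pose s : C := t%:C%C * 'i%C.
have ns : nc s = t by rewrite ncM nc_i mulr1 nc_real gtr0_norm.
have Ims : Im s = t by rewrite /= mul0r mulr1 addr0.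
exists (mmult (fun mu => (ffact_mnm b mu)%:R) (shift s p)); split.
- right; apply/stableP => v hv; apply: mmult_stable0; last by move=> i; left; exact: hv.
  move=> w hw; rewrite meval_shift; apply: (proj1 (stableP p) st) => i.
  by rewrite Im_add Ims; case: (hw i) => [h|->]; [rewrite addr_gt0|rewrite /= add0r].
- exact: msize_mmult_ffact.
move=> mu; rewrite !mcoeff_mmult -mulrBr ncM nc_nat -mcoeffB.
have [hmu|hmu] := ltnP (mdeg mu) (mdeg b).+1; last first.
  by rewrite ffact_mnm_eq0 // mul0r ltW.
apply: le_trans te; rewrite mulrC ler_pM ?nc_ge0 //; last first.
  by rewrite /F (bigD1 (BMultinom hmu)) //= lerDl sumr_ge0.
have := @cauchy_mpoly _ _ (shift s p - p) 1 (L * t) mu ler01.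
rewrite expr1n mulr1; apply=> v hv; rewrite mevalB meval_shift.
apply: hL => [|i|i|i]; first exact: ltW.
- by apply: le_trans (ncD _ _) _; rewrite ns; have := hv i; lra.
- by have := hv i; lra.
- by rewrite addrC addKr ns.
Qed.

End Multiplier.

(** * Uniform growth of stable polynomials *)

Section Growth.
Variable R : realType.
Local Notation C := R[i].
Variable m : nat.
Implicit Types (p q : {mpoly C[m]}) (v u : 'I_m -> C) (mu nu : 'X_{1..m}).

Lemma sum_geom_half N : \sum_(j < N) (2^-1 : R) ^+ j <= 2.
Proof.
suff -> : \sum_(j < N) (2^-1 : R) ^+ j = 2 - 2 * 2^-1 ^+ N.
  by rewrite gerBl mulr_ge0 // exprn_ge0 // invr_ge0.
elim: N => [|N IH]; first by rewrite big_ord0 expr0 mulr1 subrr.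
by rewrite big_ord_recr /= IH exprS; field.
Qed.

Definition hompart j p := mmult (fun mu => (mdeg mu == j)%:R) p.

Lemma mcoeff_hompart j p mu : (hompart j p)@_mu = (mdeg mu == j)%:R * p@_mu.
Proof. exact: mcoeff_mmult. Qed.

Lemma msize_hompart j p : (msize (hompart j p) <= j.+1)%N.
Proof.
apply: msize_leP => mu; rewrite mcoeff_hompart ltnS; apply: contraR.
by rewrite -ltnNge => h; rewrite (gtn_eqF h) mul0r.
Qed.

Lemma hompart_scale j p v (t : C) : (hompart j p).@[fun i => t * v i] = t ^+ j * (hompart j p).@[v].
Proof.
rewrite !meval_mmult mulr_sumr; apply: eq_bigr => mu _; rewrite mon_scale.
by case: eqP => [->|_]; rewrite ?mul0r ?mulr0 // !mul1r mulrCA.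
Qed.

Lemma sum_hompart k p v : (msize p <= k)%N -> p.@[v] = \sum_(j < k) (hompart j p).@[v].
Proof.
move=> h; rewrite (meval_wide _ h).
rewrite (eq_bigr (fun j : 'I_k => \sum_(mu : 'X_{1..m < k})
  (mdeg mu == j)%:R * p@_mu * mon mu v)); last first.
  move=> j _; rewrite (meval_wide _ (leq_trans (msize_mmult _ _) h)).
  by apply: eq_bigr => mu _; rewrite mcoeff_mmult.
rewrite exchange_big; apply: eq_bigr => mu _ /=.
rewrite (bigD1 (Ordinal (bmdeg mu))) //= eqxx mul1r big1 ?addr0 // => j jmu.
by rewrite (_ : (mdeg mu == j) = false) ?mul0r // eq_sym; apply/negbTE.
Qed.

Definition mwt (A : pred 'I_m) mu := (\sum_(i < m | A i) mu i)%N.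

Lemma mon_scale_on (A : pred 'I_m) (t : C) mu v :
  mon mu (fun i => if A i then t * v i else v i) = t ^+ mwt A mu * mon mu v.
Proof.
rewrite /mwt -prodrXr big_mkcond -big_split; apply: eq_bigr => i _ /=.
by case: ifP => _; rewrite ?mul1r ?exprMn.
Qed.

(** Scale the variables in [A] by [T > 0], divide by [T ^ d] and let [T] tend to 0. The truncated
    exponent is harmless, as coefficients of weight below [d] vanish. *)
Lemma lowest_part_stable (A : pred 'I_m) d p :
  (forall mu, (mwt A mu < d)%N -> p@_mu = 0) -> stable p ->
  let q := mmult (fun mu => (mwt A mu == d)%:R) p in q = 0 \/ stable q.
Proof.
move=> low st; apply: (@hurwitz_coef _ _ (msize p)) => [|e e0].
  by apply: leq_trans (msize_mmult _ _) _.
pose M : R := \sum_(mu <- msupp p) nc p@_mu.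
have M0 : 0 <= M by apply: sumr_ge0 => mu _; exact: nc_ge0.
have hM mu : nc p@_mu <= M.
  have [h|h] := boolP (mu \in msupp p); last by rewrite memN_msupp_eq0 // Normc.normc0.
  rewrite /M (bigD1_seq mu) ?msupp_uniq //= lerDl sumr_ge0 // => nu _; exact: nc_ge0.
pose t := Num.min 1 (e / (M + 1)).
have t0 : 0 < t by rewrite lt_min ltr01 divr_gt0 // ltr_wpDl.
have t1 : t <= 1 by rewrite ge_min lexx.
have te : t * M <= e.
  apply: (@le_trans _ _ (t * (M + 1))); first by rewrite ler_pM2l // lerDl.
  by rewrite -ler_pdivlMr ?ltr_wpDl // ge_min lexx orbT.
pose T : C := t%:C%C.
exists (mmult (fun mu => T ^+ (mwt A mu - d)) p); split.
- right; apply/stableP => v hv.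
  suff : T ^+ d * (mmult (fun mu => T ^+ (mwt A mu - d)) p).@[v] != 0.
    by rewrite mulf_eq0 negb_or => /andP[].
  rewrite meval_mmult mulr_sumr (eq_bigr (fun mu : 'X_{1..m < msize p} =>
    p@_mu * mon mu (fun i => if A i then T * v i else v i))).
    rewrite -meval_wide //; apply: (proj1 (stableP p) st) => i.
    by case: ifP => _ //; rewrite Im_mul /= mul0r addr0 mulr_gt0.
  move=> mu _; rewrite mon_scale_on; have [h|h] := ltnP (mwt A mu) d.
    by rewrite low // mulr0 !mul0r mulr0.
  by rewrite -{2}(subnKC h) exprD; ring.
- by apply: leq_trans (msize_mmult _ _) _.
move=> mu; rewrite !mcoeff_mmult -mulrBl ncM.
case: (ltngtP (mwt A mu) d) => [h|h|->].
- by rewrite low // Normc.normc0 mulr0 ltW.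
- apply: le_trans te; rewrite ler_pM ?nc_ge0 // subr0 ncX nc_real gtr0_norm //.
  have -> : (mwt A mu - d = (mwt A mu - d).-1.+1)%N by rewrite prednK // subn_gt0.
  by rewrite exprS; apply: ler_piMr; [exact: ltW|apply: exprn_ile1 => //; exact: ltW].
by rewrite subnn expr0 subrr Normc.normc0 mul0r ltW.
Qed.

Lemma hompart_stable d p : (forall mu, (mdeg mu < d)%N -> p@_mu = 0) -> stable p ->
  hompart d p = 0 \/ stable (hompart d p).
Proof.
have E mu : mwt predT mu = mdeg mu by rewrite mdegE.
move=> low st; have := @lowest_part_stable predT d p _ st.
rewrite (_ : mmult _ p = hompart d p); first by apply=> mu; rewrite E; exact: low.
by apply/mpolyP => mu; rewrite mcoeff_hompart mcoeff_mmult E.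
Qed.

Definition rvec (x : 'I_m -> R) : 'I_m -> C := fun i => (x i)%:C%C.
Definition in12 (x : 'I_m -> R) := forall i, 1 <= x i <= 2.

(** By homogeneity both points may be multiplied by [i] without changing the moduli, which moves
    them into the half-planes. Harnack's inequality applies with constant [d = 1], because
    [|1 - x i| <= x i] on [[1, 2]]; its factor [1 + 1^-1] is the 2. *)
Lemma hompart_lower d p x : hompart d p = 0 \/ stable (hompart d p) -> in12 x ->
  nc (hompart d p).@[fun=> 1] <= 2 ^+ d * nc (hompart d p).@[rvec x].
Proof.
move=> [->|st] hx; first by rewrite !meval0 Normc.normc0 mulr0.
have hi w : nc (hompart d p).@[fun i => 'i%C * w i] = nc (hompart d p).@[w].
  by rewrite hompart_scale ncM ncX nc_i expr1n mul1r.
rewrite -(hi (fun=> 1)) -(hi (rvec x)) [leRHS]mulrC.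
have -> : 2 = 1 + 1^-1 :> R by rewrite invr1.
have Imi i : Im ('i%C * rvec x i) = x i by rewrite Im_mul /= mul0r mul1r add0r.
apply: harnack => // [|i|i]; first exact: msize_hompart.
  by have /andP[h1 _] := hx i; rewrite Imi (lt_le_trans _ h1).
have /andP[h1 _] := hx i.
rewrite mul1r -mulrBr ncM nc_i mul1r Imi.
have -> : 1 - rvec x i = (1 - x i)%:C%C by rewrite rmorphB.
by rewrite nc_real ler0_norm; lra.
Qed.

Lemma hompart_upper j p (r M : R) v : 0 <= M -> (forall mu, mdeg mu = j -> nc p@_mu <= M) ->
  (forall i, nc (v i) <= r) -> 0 <= r ->
  nc (hompart j p).@[v] <= #|{: 'X_{1..m < j.+1}}|%:R * (M * r ^+ j).
Proof.
move=> M0 hM hv r0; rewrite (meval_wide _ (msize_hompart j p)).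
apply: le_trans (nc_sum _ _ _) _; rewrite mulr_natl -sumr_const.
apply: ler_sum => mu _; rewrite mcoeff_hompart.
case: eqP => [h|_].
  have hm := nc_mon_le mu hv; rewrite h in hm.
  by rewrite mul1r ncM ler_pM ?nc_ge0 ?hM.
by rewrite !mul0r Normc.normc0 mulr_ge0 ?exprn_ge0.
Qed.

Lemma ustable_ray p x : in12 x -> stable p -> forall t : C, 0 < Im t ->
  p.@[fun i => t * rvec x i] != 0.
Proof.
move=> hx st t ht; apply: (proj1 (stableP p) st) => i.
have /andP[h1 _] := hx i.
by rewrite Im_mul /= mulr0 add0r mulr_gt0 // (lt_le_trans _ h1).
Qed.

(** Free one coordinate at a time from [[1, 2]] to the disc of radius [r], at a cost of [K] each: in
    [main] the first [k] coordinates are already free. *)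
Lemma hompart_remez j p (M r : R) : 0 <= r ->
  (forall x, in12 x -> nc (hompart j p).@[rvec x] <= M) ->
  forall v, (forall i, nc (v i) <= r) ->
    nc (hompart j p).@[v] <= M * ((16 * (r + 2)) ^+ j) ^+ m.
Proof.
move=> r0 hM.
set K := (16 * (r + 2)) ^+ j.
have K0 : 0 <= K by rewrite exprn_ge0 // mulr_ge0 // addr_ge0.
have main k : (k <= m)%N -> forall v, (forall i : 'I_m, (i < k)%N -> nc (v i) <= r) ->
    (forall i : 'I_m, (k <= i)%N -> exists2 x : R, 1 <= x <= 2 & v i = x%:C%C) ->
    nc (hompart j p).@[v] <= M * K ^+ k.
  elim: k => [|k IH] km v hv1 hv2.
    rewrite expr0 mulr1; pose x i := complex.Re (v i).
    have vx i : v i = (x i)%:C%C by have [y _ E] := hv2 i isT; rewrite /x E.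
    have E : rvec x =1 v by move=> i; rewrite /rvec -vx.
    rewrite -(meval_eq _ E); apply: hM => i.
    by have [y hy Ei] := hv2 i isT; rewrite /x Ei.
  pose jk := Ordinal km.
  have E : (fun l => if l == jk then v jk else v l) =1 v by move=> l; case: eqP => [->|].
  have hs := @horner_sec _ _ j.+1 (hompart j p) v jk _ (msize_hompart _ _).
  rewrite -(meval_eq _ E) -hs exprSr mulrA; apply: remez => //; last by apply: hv1 => /=.
  - rewrite /sec; apply: leq_trans (size_sum _ _ _) _; apply/bigmax_leqP => mu _.
    apply: leq_trans (size_scale_leq _ _) _; rewrite size_polyXn ltnS.
    by have := bmdeg mu; rewrite ltnS; apply: leq_trans; rewrite mdegE (bigD1 jk) //= leq_addr.
  move=> x hx; rewrite hs; apply: IH => [|i ik|i ik]; first exact: ltnW.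
    by rewrite -val_eqE /= (ltn_eqF ik); apply: hv1; exact: ltnW.
  rewrite -val_eqE /=; case: eqP => [_|/eqP ne]; first by exists x.
  by apply: hv2; rewrite ltn_neqAle eq_sym ne.
by move=> v hv; apply: main => // i; rewrite leqNgt ltn_ord.
Qed.

(* The bound depends on [p] only through its coefficients in the three lowest
   degrees: on rays [t x] with [x] real this is Szasz's inequality, and
   Cauchy's and Remez' inequalities extend it from rays to polydiscs. *)
Lemma stable_growth (d : nat) (dl M rho : R) : 0 < dl -> 0 <= rho ->
  exists B : R, forall p, stable p -> (forall mu, (mdeg mu < d)%N -> p@_mu = 0) ->
    dl <= nc (hompart d p).@[fun=> 1] ->
    (forall mu, (mdeg mu <= d.+2)%N -> nc p@_mu <= M) ->
    forall v, (forall i, nc (v i) <= rho) -> nc p.@[v] <= B.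
Proof.
move=> dl0 rho0.
pose M' : R := \sum_(j < d.+3) #|{: 'X_{1..m < j.+1}}|%:R * (`|M| * 2 ^+ j).
(* The lower bound that [hompart_lower] gives for the lowest part in every direction of the cube. *)
pose d' : R := dl / 2 ^+ d.
have d'0 : 0 < d' by rewrite divr_gt0 // exprn_gt0.
pose K : R := (16 * (rho + 2)) ^+ m.
have K0 : 0 < K by rewrite exprn_gt0 // mulr_gt0 // ltr_wpDl.
(* On the polydisc the part of degree [d + j] is at most [G / r ^ j * K ^ (d + j)], which for
   [r = 2 K] is [G * K ^ d / 2 ^ j], a summable bound. *)
pose r := 2 * K; have r0 : 0 < r by rewrite mulr_gt0.
pose G := M' * sequences.expR (r * (M' / d') + r ^+ 2 * (3 * (M' / d') ^+ 2 + 2 * (M' / d'))).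
have M'0 : 0 <= M' by apply: sumr_ge0 => j _; rewrite !mulr_ge0 ?exprn_ge0.
have G0 : 0 <= G by rewrite mulr_ge0 // ltW // exp.expR_gt0.
exists (G * K ^+ d * 2) => p st low hdl hM v hv.
have hup j x : (j < d.+3)%N -> in12 x -> nc (hompart j p).@[rvec x] <= M'.
  move=> jd hx; apply: le_trans (@hompart_upper j p 2 `|M| _ _ _ _ _) _ => //.
  - by move=> mu hmu; apply: le_trans (hM _ _) (ler_norm _); rewrite hmu.
  - by move=> i; rewrite nc_real ger0_norm; have /andP[] := hx i; lra.
  rewrite /M' (bigD1 (Ordinal jd)) //= lerDl sumr_ge0 // => i _.
  by rewrite !mulr_ge0 ?exprn_ge0.
have hlow x : in12 x -> d' <= nc (hompart d p).@[rvec x].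
  move=> hx; rewrite ler_pdivrMr ?exprn_gt0 // mulrC.
  by apply: le_trans hdl _; apply: hompart_lower => //; exact: hompart_stable.
(* Large enough to cover [p], and above 2, so that the coefficients of [g] needed by [szasz] are not
   cut off. *)
pose N := (msize p + d.+3)%N.
have sN : (msize p <= d + N)%N by rewrite /N addnCA leq_addr.
have split_hompart w : p.@[w] = \sum_(j < N) (hompart (d + j)%N p).@[w].
  rewrite (sum_hompart _ sN) big_split_ord /= big1 ?add0r // => j _.
  suff -> : hompart j p = 0 by rewrite meval0.
  apply/mpolyP => mu; rewrite mcoeff_hompart mcoeff0; case: eqP => [h|_]; last by rewrite mul0r.
  by rewrite low ?mulr0 // h.
have ray x j : (j < N)%N -> in12 x -> nc (hompart (d + j)%N p).@[rvec x] * r ^+ j <= G.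
  move=> jN hx; pose g : {poly C} := \poly_(j < N) (hompart (d + j)%N p).@[rvec x].
  have gE t : p.@[fun i => t * rvec x i] = t ^+ d * g.[t].
    rewrite split_hompart horner_poly mulr_sumr; apply: eq_bigr => i _.
    by rewrite hompart_scale exprD -mulrA [t ^+ i * _]mulrC.
  have gst : ustable g.
    move=> t ht; have := ustable_ray hx st ht; rewrite gE mulf_eq0 negb_or.
    by case/andP.
  have cg i : (i < N)%N -> g`_i = (hompart (d + i)%N p).@[rvec x] by move=> iN; rewrite coef_poly iN.
  have N3 : (2 < N)%N by rewrite /N !addnS !ltnS.
  rewrite -cg //; apply: cauchy_poly; first exact: ltW.
  have N1 : (1 < N)%N := ltnW N3; have N0 : (0 < N)%N := ltnW N1.
  have g0 : d' <= nc g`_0 by rewrite (cg _ N0) addn0; exact: hlow.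
  have g0' : nc g`_0 <= M' by rewrite (cg _ N0) addn0; apply: hup => //; rewrite ltnS leqW.
  have g1 : nc g`_1 <= M' by rewrite (cg _ N1); apply: hup => //; rewrite addn1 !ltnS leqnSn.
  have g2 : nc g`_2 <= M' by rewrite (cg _ N3); apply: hup => //; rewrite addn2.
  by move=> t ht; exact: (szasz gst d'0 g0 g0' g1 g2 ht).
have term j : (j < N)%N -> nc (hompart (d + j)%N p).@[v] <= G * K ^+ d * 2^-1 ^+ j.
  move=> jN; have hx x : in12 x -> nc (hompart (d + j)%N p).@[rvec x] <= G / r ^+ j.
    by move=> hx; rewrite ler_pdivlMr ?exprn_gt0 //; exact: ray.
  apply: le_trans (hompart_remez rho0 hx hv) _; rewrite exprAC -/K exprD.
  have E (g a b c : R) : b != 0 -> c != 0 -> g / (c * b) * (a * b) = g * a * c^-1.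
    by move=> b0 c0; field; rewrite b0 c0.
  by rewrite exprMn E ?exprVn // expf_neq0 // gt_eqF.
rewrite split_hompart; apply: le_trans (nc_sum _ _ _) _.
apply: (@le_trans _ _ (\sum_(j < N) G * K ^+ d * 2^-1 ^+ j)).
  by apply: ler_sum => j _; exact: term.
by rewrite -mulr_sumr ler_wpM2l ?sum_geom_half // mulr_ge0 // exprn_ge0 // ltW.
Qed.

End Growth.

(** * Series in [(z, w)] *)

Section Sums.
Variable R : realType.
Variable n : nat.
Implicit Types (mu : 'X_{1..n}) (F : 'X_{1..n} -> R).

Lemma sum_bmnm_widen (V : nmodType) (G : 'X_{1..n} -> V) N N' : (N <= N')%N ->
  \sum_(a : 'X_{1..n < N}) G a = \sum_(a : 'X_{1..n < N'} | (mdeg a < N)%N) G a.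
Proof.
(* For [N = 0] the index type is empty and cannot provide the default [bm0] used below. *)
case: N => [|N] h; first by rewrite [RHS]big_pred0 // big1 // => -[].
have w (mu : 'X_{1..n}) : (mdeg mu < N.+1)%N -> (mdeg mu < N')%N.
  by move=> hm; exact: leq_trans h.
rewrite [RHS](reindex_onto (fun a : 'X_{1..n < N.+1} => BMultinom (w a (bmdeg a)) : 'X_{1..n < N'})
  (fun a => insubd (bm0 : 'X_{1..n < N.+1}) (a : 'X_{1..n}))) /=.
  by apply: eq_bigl => a; rewrite bmdeg; apply/esym/eqP/val_inj; rewrite val_insubd bmdeg.
by move=> a ha; apply/val_inj; rewrite /= val_insubd ha.
Qed.

Lemma sum_bmnm_split (V : zmodType) (G : 'X_{1..n} -> V) N N' : (N <= N')%N ->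
  \sum_(a : 'X_{1..n < N'}) G a - \sum_(a : 'X_{1..n < N}) G a =
  \sum_(a : 'X_{1..n < N'} | (N <= mdeg a)%N) G a.
Proof.
move=> h; rewrite (sum_bmnm_widen _ h) [in X in X - _](bigID (fun a : 'X_{1..n < N'} => (mdeg a < N)%N)) /=.
by rewrite addrAC subrr add0r; apply: eq_bigl => a; rewrite -leqNgt.
Qed.

(** The multi-indices embed into a box, over which the sum is a product of [n] geometric sums, each
    at most 2. *)
Lemma sum_mdeg_geom N : \sum_(a : 'X_{1..n < N}) (2^-1 : R) ^+ mdeg a <= 2 ^+ n.
Proof.
pose h (a : 'X_{1..n < N}) : {ffun 'I_n -> 'I_N.+1} := [ffun i => inord (a i)].
have ha (a : 'X_{1..n < N}) i : (a i < N.+1)%N.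
  by rewrite ltnS ltnW // (leq_trans _ (bmdeg a)) // ltnS mdegE (bigD1 i) //= leq_addr.
have hI : injective h.
  move=> a b /ffunP E; apply/val_inj/mnmP => i; have := E i.
  by rewrite !ffunE => /(congr1 val); rewrite /= !inordK.
have -> : \sum_(a : 'X_{1..n < N}) (2^-1 : R) ^+ mdeg a =
    \sum_(f in [set h a | a in setT]) \prod_(i < n) (2^-1 : R) ^+ (f i).
  rewrite big_imset /=; last by move=> a b _ _; exact: hI.
  apply: eq_big => [a|a _]; first by rewrite in_setT.
  by rewrite mdegE -prodrXr; apply: eq_bigr => i _; rewrite ffunE inordK.
apply: (@le_trans _ _ (\sum_(f : {ffun 'I_n -> 'I_N.+1}) \prod_(i < n) (2^-1 : R) ^+ (f i))).
  rewrite [leRHS](bigID (mem [set h a | a in setT])) /= lerDl sumr_ge0 // => f _.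
  by apply: prodr_ge0 => i _; rewrite exprn_ge0 // invr_ge0.
rewrite -(bigA_distr_bigA (fun (i : 'I_n) (j : 'I_N.+1) => (2^-1 : R) ^+ j)) prodr_const card_ord.
by rewrite lerXn2r ?nnegrE ?sum_geom_half ?sumr_ge0 // => i _; rewrite exprn_ge0 // invr_ge0.
Qed.

Lemma bounded_nondecreasing_cauchy (A : nat -> R) (B : R) :
  (forall N N', (N <= N')%N -> A N <= A N') -> (forall N, A N <= B) ->
  forall e : R, 0 < e -> exists N0, forall N, (N0 <= N)%N -> A N - A N0 <= e.
Proof.
move=> mono bd e e0; pose S : classical_sets.set R := fun x => exists N, x = A N.
have hS : classical_sets.has_sup S.
  by split; [exists (A 0%N), 0%N|exists B => _ [N ->]].
have [_ [N0 ->] h] := sup_adherent e0 hS.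
exists N0 => N _; have : A N <= sup S by apply: ub_le_sup; [case: hS|exists N].
lra.
Qed.

Lemma mdeg_tail_small (e : R) : 0 < e -> exists N0, forall N, (N0 <= N)%N ->
  \sum_(a : 'X_{1..n < N} | (N0 <= mdeg a)%N) (2^-1 : R) ^+ mdeg a <= e.
Proof.
move=> e0; pose A N := \sum_(a : 'X_{1..n < N}) (2^-1 : R) ^+ mdeg a.
have [|N0 h] := @bounded_nondecreasing_cauchy A (2 ^+ n) _ sum_mdeg_geom e e0.
  move=> N N' NN'; rewrite -subr_ge0 /A (sum_bmnm_split (fun a => 2^-1 ^+ mdeg a) NN').
  by apply: sumr_ge0 => a _; rewrite exprn_ge0 // invr_ge0.
exists N0 => N hN; rewrite -(sum_bmnm_split (fun a => 2^-1 ^+ mdeg a) hN).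
exact: h.
Qed.

Definition cst_mnm (k : nat) : 'X_{1..n} := [multinom k | i < n].

(** For [a <= k] the ratio is the product of the [1 - i / k] with [i < a]; beyond [k] it is 0. The
    induction uses [r s >= r + s - 1] for [r, s <= 1]. The explicit rate allows explicit choices of
    [k] later. *)
Lemma ffact_ratio1 (a k : nat) : (0 < k)%N ->
  let r : R := (k ^_ a)%:R / k%:R ^+ a in 1 - a%:R ^+ 2 / k%:R <= r /\ 0 <= r <= 1.
Proof.
move=> k0; have K0 : 0 < k%:R :> R by rewrite ltr0n.
elim: a => [|a [h1 /andP[h2 h3]]] /=.
  by rewrite ffactn0 expr0 divr1 expr0n mul0r subr0 ler01 lexx.
set r := (k ^_ a)%:R / _ in h1 h2 h3 *.
have -> : (k ^_ a.+1)%:R / k%:R ^+ a.+1 = r * ((k - a)%N%:R / k%:R) :> R.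
  by rewrite ffactnSr natrM exprSr invfM /r; ring.
set s := (k - a)%N%:R / k%:R.
have s0 : 0 <= s by rewrite divr_ge0.
have s1 : s <= 1 by rewrite ler_pdivrMr // mul1r ler_nat leq_subr.
have s2 : 1 - a%:R / k%:R <= s.
  have [h|h] := leqP a k.
    by rewrite /s natrB // mulrBl divff // gt_eqF.
  by apply: le_trans s0; rewrite subr_le0 ler_pdivlMr // mul1r ler_nat ltnW.
split; last by rewrite mulr_ge0 //= mulr_ile1.
have h4 : a%:R ^+ 2 / k%:R + a%:R / k%:R <= a.+1%:R ^+ 2 / k%:R :> R.
  rewrite -mulrDl ler_pM2r ?invr_gt0 // -natr1; have := ler0n R a; nra.
have : 0 <= (1 - r) * (1 - s) by rewrite mulr_ge0 // subr_ge0.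
lra.
Qed.

Lemma ffact_ratio (k : nat) mu : (0 < k)%N ->
  let r : R := (ffact_mnm (cst_mnm k) mu)%:R / k%:R ^+ mdeg mu in
  1 - (mdeg mu)%:R ^+ 2 / k%:R <= r /\ 0 <= r <= 1.
Proof.
move=> k0 /=; have K0 : 0 < k%:R :> R by rewrite ltr0n.
rewrite mdegE -prodrXr /ffact_mnm natr_prod -prodf_div.
rewrite natr_sum.
have Rh : forall s : seq 'I_n,
    1 - (\sum_(i <- s) (mu i)%:R) ^+ 2 / k%:R <= \prod_(i <- s) ((cst_mnm k i ^_ mu i)%:R / k%:R ^+ mu i : R)
    /\ 0 <= \prod_(i <- s) ((cst_mnm k i ^_ mu i)%:R / k%:R ^+ mu i : R) <= 1.
  elim=> [|i s [h1 /andP[h2 h3]]].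
    by rewrite !big_nil expr0n mul0r subr0 ler01 lexx.
  rewrite !big_cons mnmE; have [g1 /andP[g2 g3]] := ffact_ratio1 (mu i) k0.
  move: h1 h2 h3; set S := \sum_(j <- s) _; set X := \prod_(j <- s) _ => h1 h2 h3.
  move: g1 g2 g3; set Y := (k ^_ mu i)%:R / _ => g1 g2 g3.
  have S0 : 0 <= S by apply: sumr_ge0.
  split; last by rewrite mulr_ge0 //= mulr_ile1.
  have h4 : (mu i)%:R ^+ 2 / k%:R + S ^+ 2 / k%:R <= ((mu i)%:R + S) ^+ 2 / k%:R :> R.
    rewrite -mulrDl ler_pM2r ?invr_gt0 //; have := ler0n R (mu i); nra.
  have : 0 <= (1 - Y) * (1 - X) by rewrite mulr_ge0 // subr_ge0.
  lra.
exact: Rh.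
Qed.

End Sums.

(** * Polynomials in [(z, w)] built from the coefficients [P_a] *)

Section Series.
Variable R : realType.
Local Notation C := R[i].
Variable n : nat.
Implicit Types (P : 'X_{1..n} -> {mpoly C[n]}) (v : 'I_(n + n) -> C).

Definition zmnm (nu : 'X_{1..n + n}) : 'X_{1..n} := [multinom nu (lshift n i) | i < n].
Definition wmnm (nu : 'X_{1..n + n}) : 'X_{1..n} := [multinom nu (rshift n i) | i < n].
Definition join_mnm (mu a : 'X_{1..n}) : 'X_{1..n + n} :=
  [multinom match split i with inl j => mu j | inr j => a j end | i < n + n].

Lemma join_lshift mu a i : join_mnm mu a (lshift n i) = mu i.
Proof. by rewrite mnmE (unsplitK (inl i)). Qed.
Lemma join_rshift mu a i : join_mnm mu a (rshift n i) = a i.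
Proof. by rewrite mnmE (unsplitK (inr i)). Qed.
Lemma zmnm_join mu a : zmnm (join_mnm mu a) = mu.
Proof. by apply/mnmP => i; rewrite mnmE join_lshift. Qed.
Lemma wmnm_join mu a : wmnm (join_mnm mu a) = a.
Proof. by apply/mnmP => i; rewrite mnmE join_rshift. Qed.
Lemma join_mnmK nu : join_mnm (zmnm nu) (wmnm nu) = nu.
Proof.
apply/mnmP => i; rewrite mnmE; have <- := splitK i.
by case: (split i) => j; rewrite unsplitK mnmE.
Qed.
Lemma mdeg_zw nu : mdeg nu = (mdeg (zmnm nu) + mdeg (wmnm nu))%N.
Proof.
by rewrite !mdegE big_split_ord /=; congr (_ + _)%N; apply: eq_bigr => i _; rewrite mnmE.
Qed.

Lemma ffact_join b c nu :
  ffact_mnm (join_mnm b c) nu = (ffact_mnm b (zmnm nu) * ffact_mnm c (wmnm nu))%N.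
Proof.
rewrite /ffact_mnm big_split_ord /=; congr (_ * _)%N; apply: eq_bigr => i _.
  by rewrite join_lshift mnmE.
by rewrite join_rshift mnmE.
Qed.

Definition zwterm (p : {mpoly C[n]}) (a : 'X_{1..n}) : {mpoly C[n + n]} :=
  (p \mPo [tuple 'X_(lshift n i) | i < n]) * \prod_(i < n) 'X_(rshift n i) ^+ (a i).

Lemma mcoeff_zwterm p a nu : (zwterm p a)@_nu = p@_(zmnm nu) * (a == wmnm nu)%:R.
Proof.
have E : zwterm p a = \sum_(mu <- msupp p) p@_mu *: 'X_[join_mnm mu a].
  rewrite /zwterm comp_mpolyE mulr_suml; apply: eq_bigr => mu _.
  rewrite -scalerAl; congr (_ *: _); rewrite mpolyXE_id big_split_ord /=.
  congr (_ * _); apply: eq_bigr => i _; last by rewrite join_rshift.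
  by rewrite tnth_mktuple join_lshift.
rewrite E raddf_sum /=.
have J mu : (join_mnm mu a == nu) = (mu == zmnm nu) && (a == wmnm nu).
  apply/eqP/andP => [<-|[/eqP -> /eqP ->]]; first by rewrite zmnm_join wmnm_join.
  exact: join_mnmK.
have [h|h] := boolP (zmnm nu \in msupp p).
  rewrite (bigD1_seq (zmnm nu)) ?msupp_uniq //= mcoeffZ mcoeffX J eqxx /=.
  rewrite big1 ?addr0 // => mu /negbTE nmu; by rewrite mcoeffZ mcoeffX J nmu mulr0.
rewrite (memN_msupp_eq0 h) mul0r big1_seq // => mu /andP[_ hmu].
rewrite mcoeffZ mcoeffX J; case: eqP hmu h => [->->//|_ _ _]; exact: mulr0.
Qed.

Lemma meval_zwterm p a v :
  (zwterm p a).@[v] = p.@[zpart v] * \prod_(i < n) (wpart v i) ^+ a i.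
Proof.
rewrite mevalM comp_mpoly_meval; congr (_ * _).
  by apply: meval_eq => i; rewrite tnth_mktuple mevalXU.
rewrite rmorph_prod; apply: eq_bigr => i _ /=.
by rewrite rmorphXn /= mevalXU.
Qed.

(** The common form of the truncations, the partial sums and the approximants of [F]: weights [L]
    and a cut in the [w]-degree. *)
Definition ser (L : 'X_{1..n} -> C) P N : {mpoly C[n + n]} :=
  \sum_(a : 'X_{1..n < N}) L a *: zwterm (P a) a.

Lemma mcoeff_ser L P N nu : (ser L P N)@_nu =
  if (mdeg (wmnm nu) < N)%N then L (wmnm nu) * (P (wmnm nu))@_(zmnm nu) else 0.
Proof.
rewrite /ser raddf_sum /=; case: ltnP => h.
  rewrite (bigD1 (BMultinom h)) //= big1 => [|a ha].
    by rewrite mcoeffZ mcoeff_zwterm eqxx mulr1 addr0.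
  rewrite mcoeffZ mcoeff_zwterm (_ : (_ == wmnm nu) = false) ?mulr0 //.
  by apply: contraNF ha => /eqP E; apply/eqP/val_inj.
rewrite big1 // => a _; rewrite mcoeffZ mcoeff_zwterm.
case: eqP => [E|_]; last by rewrite !mulr0.
by have := bmdeg a; rewrite E ltnNge h.
Qed.

Lemma meval_ser L P N v :
  (ser L P N).@[v] = \sum_(a : 'X_{1..n < N}) L a * series_term P a v.
Proof.
rewrite /ser raddf_sum /=; apply: eq_bigr => a _.
by rewrite mevalZ meval_zwterm.
Qed.

Lemma ffact_mnm_nlem (b a : 'X_{1..n}) : ~~ (a <= b)%MM -> ffact_mnm b a = 0%N.
Proof.
move=> hn; have : ~~ [forall i, a i <= b i]%N.
  by apply: contra hn => /forallP h; apply/mnm_lepP.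
rewrite negb_forall => /existsP[j]; rewrite -ltnNge => h.
by rewrite /ffact_mnm (bigD1 j) //= ffact_small.
Qed.

Lemma trunc_ser P b : trunc_poly P b = ser (fun a => (ffact_mnm b a)%:R) P (mdeg b).+1.
Proof.
rewrite /trunc_poly /ser big_mkcond; apply: eq_bigr => a _.
by case: ifP => // /negbT /ffact_mnm_nlem ->; rewrite scale0r.
Qed.

Lemma mcoeff_trunc P b nu :
  (trunc_poly P b)@_nu = (ffact_mnm b (wmnm nu))%:R * (P (wmnm nu))@_(zmnm nu).
Proof.
rewrite trunc_ser mcoeff_ser; case: ltnP => // h.
by rewrite ffact_mnm_eq0 // mul0r.
Qed.

Lemma trunc_over K P b : (forall a, mpoly_over K (P a)) -> mpoly_over K (trunc_poly P b).
Proof.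
move=> h nu; rewrite mcoeff_trunc; move: (h (wmnm nu) (zmnm nu)).
case: K {h} => //= /eqP h; rewrite mulr_natl raddfMn /=.
by rewrite h mul0rn.
Qed.

End Series.

(** * Limits of stable polynomials *)

Section Forward.
Variable R : realType.
Local Notation C := R[i].

Lemma norm_ltC (x : C) (e : R) : (`|x| < e%:C%C) = (nc x < e).
Proof. by rewrite normE ltcR. Qed.
Lemma norm_leC (x : C) (e : R) : (`|x| <= e%:C%C) = (nc x <= e).
Proof. by rewrite normE lecR. Qed.

Lemma mmult_mon_stable m (q : {mpoly C[m]}) (r : 'I_m -> R) : (forall i, 0 < r i) ->
  q = 0 \/ stable q ->
  let q' := mmult (fun mu => mon mu (fun i => (r i)%:C%C)) q in q' = 0 \/ stable q'.
Proof.
move=> r0 [->|st]; [left|right].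
  by apply/mpolyP => mu; rewrite mcoeff_mmult !mcoeff0 mulr0.
apply/stableP => v hv; rewrite meval_mmult_mon; apply: (proj1 (stableP q) st) => i.
by rewrite Im_mul /= mul0r addr0 mulr_gt0.
Qed.

Variable n : nat.

Definition zwjoin_real (x y : R) (i : 'I_(n + n)) : R := if split i is inl _ then x else y.

Lemma zwjoin_real_gt0 x y : 0 < x -> 0 < y -> forall i, 0 < zwjoin_real x y i.
Proof. by move=> x0 y0 i; rewrite /zwjoin_real; case: (split i). Qed.

Lemma mon_zwjoin_real (nu : 'X_{1..n + n}) x y :
  mon nu (fun i => (zwjoin_real x y i)%:C%C) =
  (x ^+ mdeg (zmnm nu) * y ^+ mdeg (wmnm nu))%:C%C.
Proof.
rewrite /mon big_split_ord !mdegE -!prodrXr rmorphM !rmorph_prod /=.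
congr (_ * _); apply: eq_bigr => i _.
  by rewrite /zwjoin_real (unsplitK (inl i)) rmorphXn mnmE.
by rewrite /zwjoin_real (unsplitK (inr i)) rmorphXn mnmE.
Qed.

Implicit Types (P : 'X_{1..n} -> {mpoly C[n]}) (v : 'I_(n + n) -> C).

Lemma partial_sum_ser P N v : partial_sum P N v = (ser (fun=> 1) P N).@[v].
Proof. by rewrite meval_ser; apply: eq_bigr => a _; rewrite mul1r. Qed.

Lemma nc_series_term P a v : nc (series_term P a v) =
  nc (P a).@[zpart v] * \prod_(i < n) nc (wpart v i) ^+ a i.
Proof.
by rewrite /series_term ncM nc_prod; congr (_ * _); apply: eq_bigr => i _; rewrite ncX.
Qed.

Definition zwjoin (z w : 'I_n -> C) : 'I_(n + n) -> C :=
  fun i => match split i with inl j => z j | inr j => w j end.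

Lemma zpart_join z w : zpart (zwjoin z w) =1 z.
Proof. by move=> i; rewrite /zpart /zwjoin (unsplitK (inl i)). Qed.
Lemma wpart_join z w : wpart (zwjoin z w) =1 w.
Proof. by move=> i; rewrite /wpart /zwjoin (unsplitK (inr i)). Qed.
Lemma zwjoin_ind (Q : C -> Prop) z w : (forall i, Q (z i)) -> (forall i, Q (w i)) ->
  forall i, Q (zwjoin z w i).
Proof. by move=> hz hw i; rewrite /zwjoin; case: (split i). Qed.

Lemma series_term_join P a z w :
  series_term P a (zwjoin z w) = (P a).@[z] * mon a w.
Proof.
rewrite /series_term (meval_eq _ (zpart_join z w)); congr (_ * _).
by apply: eq_bigr => i _; rewrite wpart_join.
Qed.

Lemma series_conv P f v (e : R) : series_defines P f -> 0 < e ->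
  exists N0, forall N, (N0 <= N)%N -> nc (partial_sum P N v - f v) < e.
Proof.
move=> hs e0; have [_ h] := hs v; have [N0 hN] := h e e0.
by exists N0 => N /hN; rewrite norm_ltC.
Qed.

Lemma partial_sum_tail P v N N' : (N <= N')%N ->
  nc (partial_sum P N' v - partial_sum P N v) <=
  \sum_(a : 'X_{1..n < N'} | (N <= mdeg a)%N) nc (series_term P a v).
Proof.
move=> h; rewrite /partial_sum (sum_bmnm_split (fun a => series_term P a v) h).
exact: nc_sum.
Qed.

(** Weierstrass' M-test: it makes the pointwise convergence uniform on [V]. *)
Lemma uniform_tail P f (V : ('I_(n + n) -> C) -> Prop) (B : R) :
  (forall v a, V v -> nc (series_term P a v) <= B * 2^-1 ^+ mdeg a) ->
  (forall v (e : R), V v -> 0 < e ->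
     exists N0, forall N, (N0 <= N)%N -> nc (partial_sum P N v - f v) < e) ->
  forall e : R, 0 < e -> exists N0, forall N, (N0 <= N)%N -> forall v, V v ->
    nc (partial_sum P N v - f v) <= e.
Proof.
move=> hB conv e e0; have e2 : 0 < e / 2 by lra.
have B0 : 0 < `|B| + 1 by rewrite ltr_wpDl.
have [N0 hN0] := @mdeg_tail_small R n (e / 2 / (`|B| + 1)) (divr_gt0 e2 B0).
(* [N1] depends on [v], but only serves to reach [f v]; the threshold [N0] does not. *)
exists N0 => N hN v hv; have [N1 hN1] := conv v (e / 2) hv e2.
pose N' := maxn N N1; have NN' : (N <= N')%N by rewrite leq_maxl.
apply: le_trans (ncBD _ (partial_sum P N' v) _) _.
have -> : e = e / 2 + e / 2 by field.
apply: lerD; last by apply/ltW/hN1; rewrite leq_maxr.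
rewrite ncBC; apply: le_trans (partial_sum_tail _ _ NN') _.
apply: (@le_trans _ _ ((`|B| + 1) *
    \sum_(a : 'X_{1..n < N'} | (N0 <= mdeg a)%N) 2^-1 ^+ mdeg a)); last first.
  by rewrite mulrC -ler_pdivlMr // hN0 // (leq_trans hN).
rewrite mulr_sumr [leLHS]big_mkcond [leRHS]big_mkcond; apply: ler_sum => a _.
have p0 : 0 <= (2^-1 : R) ^+ mdeg a by rewrite exprn_ge0 // invr_ge0.
case: ifP => ha; last by case: ifP => _ //; rewrite mulr_ge0 // ltW.
rewrite (leq_trans hN ha); apply: le_trans (hB v a hv) _.
by rewrite ler_wpM2r //; have := ler_norm B; lra.
Qed.

(** Cauchy's estimate in [w] is applied to a partial sum, which must be close to [f] uniformly in
    [w]. Its terms are dominated by those at [(z; 2,..,2)], whose absolute convergence makes the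
    tail at most 1; another 1 is spent on the limit, whence [B + 2]. *)
Lemma series_coef_bound P f (B : R) : series_defines P f ->
  (forall v, (forall i, nc (v i) <= 2) -> nc (f v) <= B) ->
  forall z a, (forall i, nc (z i) <= 2) -> nc (P a).@[z] * 2 ^+ mdeg a <= B + 2.
Proof.
move=> hs hB z a hz; pose x0 := zwjoin z (fun=> 2).
pose A N := \sum_(c : 'X_{1..n < N}) nc (series_term P c x0).
have term_ge0 c : 0 <= nc (series_term P c x0) := nc_ge0 _.
have mono N N' : (N <= N')%N -> A N <= A N'.
  move=> h; rewrite -subr_ge0 /A (sum_bmnm_split (fun c => nc (series_term P c x0)) h).
  by apply: sumr_ge0.
have [[B0 hB0] _] := hs x0.
have bd N : A N <= B0.
  have := hB0 N; rewrite (eq_bigr (fun c : 'X_{1..n < N} => (nc (series_term P c x0))%:C%C)) //.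
  by rewrite -rmorph_sum lecR.
have [N0 hN0] := bounded_nondecreasing_cauchy mono bd ltr01.
pose N := maxn N0 (mdeg a).+1.
have aN : (mdeg a < N)%N by rewrite leq_maxr.
pose q : {mpoly C[n]} := \sum_(c : 'X_{1..n < N}) (P c).@[z] *: 'X_[c].
have qa : q@_a = (P a).@[z] by rewrite (mcoeff_mpoly (fun c => (P c).@[z])).
have qE w : q.@[w] = partial_sum P N (zwjoin z w).
  rewrite /q raddf_sum /=; apply: eq_bigr => c _.
  by rewrite mevalZ mevalX series_term_join.
rewrite -qa; apply: cauchy_mpoly => // w hw; rewrite qE.
set v := zwjoin z w.
have [N1 hN1] := series_conv v hs ltr01.
pose N' := maxn N N1; have NN' : (N <= N')%N by rewrite leq_maxl.
have h1 : nc (partial_sum P N' v - f v) <= 1 by apply/ltW/hN1; rewrite leq_maxr.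
have h2 : nc (f v) <= B by apply: hB; apply: (zwjoin_ind (Q := fun x => nc x <= 2)).
have h3 : nc (partial_sum P N' v - partial_sum P N v) <= 1.
  apply: le_trans (partial_sum_tail _ _ NN') _.
  apply: (@le_trans _ _ (A N' - A N)).
    rewrite /A (sum_bmnm_split (fun c => nc (series_term P c x0)) NN').
    apply: ler_sum => c _; rewrite /x0 /v !series_term_join !ncM ler_wpM2l ?nc_ge0 //.
    apply: le_trans (nc_mon_le _ hw) _.
    by rewrite nc_prod mdegE -prodrXr le_eqVlt; apply/orP; left; apply/eqP/eq_bigr => i _; rewrite ncX nc_nat.
  have := hN0 N' (leq_trans (leq_maxl _ _) NN').
  by have := mono N0 N (leq_maxl _ _); lra.
have -> : partial_sum P N v =
    f v + ((partial_sum P N' v - f v) - (partial_sum P N' v - partial_sum P N v)) by ring.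
apply: le_trans (ncD _ _) _; have := ncB (partial_sum P N' v - f v) (partial_sum P N' v - partial_sum P N v).
by move: h1 h2 h3; move: (nc _) (nc _) (nc _) (nc _); clear; move=> *; lra.
Qed.

(** The bound at radius 2 makes the series converge uniformly on the unit polydisc, where Cauchy's
    estimate compares [ps k] with a partial sum. One [k] serves all [nu]. *)
Lemma coef_conv P f ps : series_defines P f ->
  (forall (r eps : R), 0 < eps -> exists N : nat, forall k : nat, (N <= k)%N ->
      forall v : 'I_(n + n) -> C, (forall i, `|v i| <= r%:C%C) ->
        `|(ps k).@[v] - f v| < eps%:C%C) ->
  forall e : R, 0 < e -> exists k, forall nu,
    nc ((ps k)@_nu - (P (wmnm nu))@_(zmnm nu)) <= e.
Proof.
move=> hs hps.
have [B hB] : exists B : R, forall v, (forall i, nc (v i) <= 2) -> nc (f v) <= B.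
  have [k hk] := hps 2 1 ltr01; have [B0 _ hB0] := meval_bounded (ps k) 2.
  exists (B0 + 1) => v hv; have := hk k (leqnn k) v; rewrite norm_ltC => h.
  have -> : f v = (ps k).@[v] - ((ps k).@[v] - f v) by ring.
  apply: le_trans (ncB _ _) _; apply: lerD; first exact: hB0.
  by apply/ltW/h => i; rewrite norm_leC.
have hc := series_coef_bound hs hB.
move=> e e0; have e2 : 0 < e / 2 by lra.
pose V v := forall i, nc (v i) <= 1.
have hV v a : V v -> nc (series_term P a v) <= (B + 2) * 2^-1 ^+ mdeg a.
  move=> hv; rewrite nc_series_term exprVn ler_pdivlMr ?exprn_gt0 // mulrAC.
  have hv2 i : nc (zpart v i) <= 2 by apply: le_trans (hv _) _; lra.
  apply: le_trans (hc _ a hv2); rewrite ler_piMr ?mulr_ge0 ?nc_ge0 ?exprn_ge0 //.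
  by apply: prodr_ile1 => i; rewrite exprn_ge0 ?exprn_ile1 ?nc_ge0 //; apply: hv.
have [N0 hN0] := uniform_tail hV (fun v e _ e0 => series_conv v hs e0) e2.
have [k hk] := hps 1 (e / 2) e2; exists k => nu.
pose N := maxn N0 (mdeg (wmnm nu)).+1.
have <- : (ser (fun=> 1) P N)@_nu = (P (wmnm nu))@_(zmnm nu).
  by rewrite mcoeff_ser leq_maxr mul1r.
rewrite -mcoeffB; have := @cauchy_mpoly _ _ (ps k - ser (fun=> 1) P N) 1 e nu ler01.
rewrite expr1n mulr1; apply=> v hv; rewrite mevalB -partial_sum_ser.
apply: le_trans (ncBD _ (f v) _) _; have -> : e = e / 2 + e / 2 by field.
apply: lerD; last by rewrite ncBC; apply: hN0 => //; rewrite leq_maxl.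
by apply: ltW; rewrite -norm_ltC; apply: hk => // i; rewrite norm_leC.
Qed.

Lemma trunc_limit P f b : series_defines P f -> Hbar_C f ->
  trunc_poly P b = 0 \/ stable (trunc_poly P b).
Proof.
move=> hs [ps [st hps]]; have hc := coef_conv hs hps.
pose N := (mdeg b).+1.
(* This is [T_(g,b) F]: the cut at [N] loses nothing, since the multiplier of [b] annihilates higher
   [w]-degrees. *)
pose T g := mmult (fun nu => (ffact_mnm (join_mnm (cst_mnm n g) b) nu)%:R) (ser (fun=> 1) P N).
have cT g nu : (T g)@_nu = (ffact_mnm (cst_mnm n g) (zmnm nu))%:R * (trunc_poly P b)@_nu.
  rewrite mcoeff_mmult mcoeff_trunc mcoeff_ser ffact_join natrM -mulrA; congr (_ * _).
  by case: ltnP => h; rewrite ?mul1r // ffact_mnm_eq0 // !mul0r.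
(* First limit, [g] fixed: the images of the [ps k] have bounded degree and their coefficients
   converge. *)
have hT g : T g = 0 \/ stable (T g).
  apply: (@hurwitz_coef _ _ (mdeg (join_mnm (cst_mnm n g) b))); first exact: msize_mmult_ffact.
  move=> e e0; set D := mdeg _.
  pose F : R := \sum_(nu : 'X_{1..(n + n) < D.+1}) (ffact_mnm (join_mnm (cst_mnm n g) b) nu)%:R.
  have F0 : 0 < F + 1 by rewrite ltr_wpDl // sumr_ge0.
  have [k hk] := hc (e / (F + 1)) (divr_gt0 e0 F0).
  exists (mmult (fun nu => (ffact_mnm (join_mnm (cst_mnm n g) b) nu)%:R) (ps k)); split.
  - exact: mmult_ffact_stable.
  - exact: msize_mmult_ffact.
  move=> nu; rewrite !mcoeff_mmult -mulrBr ncM nc_nat.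
  have [h|h] := ltnP (mdeg nu) D.+1; last by rewrite ffact_mnm_eq0 // mul0r ltW.
  have hF : (ffact_mnm (join_mnm (cst_mnm n g) b) nu)%:R <= F + 1.
    by rewrite /F (bigD1 (BMultinom h)) //= -addrA lerDl addr_ge0 // sumr_ge0.
  have [hw|hw] := ltnP (mdeg (wmnm nu)) N; last first.
    by rewrite ffact_join (ffact_mnm_eq0 hw) muln0 mul0r ltW.
  rewrite mcoeff_ser hw mul1r; apply: (@le_trans _ _ ((F + 1) * (e / (F + 1)))).
    by rewrite ler_pM ?nc_ge0 ?hk.
  by rewrite mulrC divfK // gt_eqF.
(* Second limit: after scaling [z] by [1 / g], the factors are the ratios of [ffact_ratio], which
   tend to 1 as [g] grows. *)
apply: (@hurwitz_coef _ _ (msize (trunc_poly P b))) => // e e0.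
pose p := trunc_poly P b.
pose M : R := \sum_(nu <- msupp p) (mdeg (zmnm nu))%:R ^+ 2 * nc p@_nu.
have M0 : 0 <= M by apply: sumr_ge0 => nu _; rewrite mulr_ge0 ?nc_ge0 ?sqr_ge0.
pose g := (Num.trunc (M / e)).+1.
have g0 : 0 < g%:R :> R by rewrite ltr0n.
have Mg : M / g%:R <= e.
  by rewrite ler_pdivrMr // -ler_pdivrMl // mulrC ltW // truncnS_gt.
pose r := zwjoin_real (g%:R^-1) 1.
exists (mmult (fun mu => mon mu (fun i => (r i)%:C%C)) (T g)); split.
- by apply: mmult_mon_stable => //; apply: zwjoin_real_gt0; rewrite ?invr_gt0.
- apply: msize_leP => nu; rewrite mcoeff_mmult cT => h; rewrite ltnS ltnW //.
  by apply: msize_mdeg_lt; rewrite mcoeff_msupp; apply: contraNneq h => ->; rewrite !mulr0.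
move=> nu; rewrite mcoeff_mmult cT -/p mulrA.
have -> : mon nu (fun i => (r i)%:C%C) = ((g%:R^-1 : R) ^+ mdeg (zmnm nu))%:C%C.
  by rewrite mon_zwjoin_real expr1n mulr1.
have [h1 /andP[h2 h3]] := @ffact_ratio R n g (zmnm nu) (ltn0Sn _).
set fr := _%:R / _ in h1 h2 h3.
have -> : ((g%:R^-1 : R) ^+ mdeg (zmnm nu))%:C%C * (ffact_mnm (cst_mnm n g) (zmnm nu))%:R = fr%:C%C :> C.
  by rewrite -(rmorph_nat (real_complex R)) -rmorphM /= /fr exprVn mulrC.
rewrite -[X in _ - X]mul1r -mulrBl ncM -(rmorph1 (real_complex R)) -rmorphB nc_real.
apply: le_trans Mg; have [hin|hin] := boolP (nu \in msupp p); last first.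
  by rewrite (memN_msupp_eq0 hin) Normc.normc0 mulr0 divr_ge0 // ltW.
apply: (@le_trans _ _ ((mdeg (zmnm nu))%:R ^+ 2 / g%:R * nc p@_nu)).
  by rewrite ler_wpM2r ?nc_ge0 // ler0_norm; lra.
rewrite mulrAC ler_pM2r ?invr_gt0 // /M (bigD1_seq nu) ?msupp_uniq //= lerDl.
by apply: sumr_ge0 => i _; rewrite mulr_ge0 ?nc_ge0 ?sqr_ge0.
Qed.

End Forward.

(** * Convergence of the rescaled truncations *)

Section Limits.
Variable R : realType.
Local Notation C := R[i].

(** The limit is obtained as the supremum of the numbers that are eventually below [u]. *)
Lemma real_cauchy_limit (u : nat -> R) :
  (forall e : R, 0 < e -> exists N0, forall N, (N0 <= N)%N -> `|u N - u N0| <= e) ->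
  exists l, forall e : R, 0 < e -> exists N0, forall N, (N0 <= N)%N -> `|u N - l| <= e.
Proof.
move=> cau; pose S : classical_sets.set R := fun x => exists N0, forall N, (N0 <= N)%N -> x <= u N.
have up (e : R) N0 : (forall N, (N0 <= N)%N -> `|u N - u N0| <= e) -> classical_sets.ubound S (u N0 + e).
  move=> h x [N1 hx]; have := hx _ (leq_maxl N1 N0).
  by have := h _ (leq_maxr N1 N0); rewrite ler_norml => /andP[]; lra.
have lo (e : R) N0 : (forall N, (N0 <= N)%N -> `|u N - u N0| <= e) -> S (u N0 - e).
  by move=> h; exists N0 => N /h; rewrite ler_norml => /andP[]; lra.
have hS : classical_sets.has_sup S.
  have [N0 h] := cau 1 ltr01; split; [exists (u N0 - 1); exact: lo|exists (u N0 + 1); exact: up].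
exists (sup S) => e e0; have e2 : 0 < e / 2 by lra.
have [N0 h] := cau _ e2; exists N0 => N /h.
have := ub_le_sup hS.2 (lo _ _ h); have := ge_sup hS.1 (up _ _ h).
rewrite !ler_norml => h1 h2 /andP[h3 h4]; apply/andP; split; lra.
Qed.

Lemma complex_cauchy_limit (u : nat -> C) :
  (forall e : R, 0 < e -> exists N0, forall N, (N0 <= N)%N -> nc (u N - u N0) <= e) ->
  exists l, forall e : R, 0 < e -> exists N0, forall N, (N0 <= N)%N -> nc (u N - l) < e.
Proof.
move=> cau.
have [|a ha] := @real_cauchy_limit (fun N => Re (u N)).
  move=> e /cau[N0 h]; exists N0 => N /h; apply: le_trans.
  by rewrite -Re_opp -Re_add; exact: nc_Re.
have [|b hb] := @real_cauchy_limit (fun N => Im (u N)).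
  move=> e /cau[N0 h]; exists N0 => N /h; apply: le_trans.
  by rewrite -Im_opp -Im_add; exact: nc_Im.
exists (Complex a b) => e e0; have e3 : 0 < e / 3 by lra.
have [N1 h1] := ha _ e3; have [N2 h2] := hb _ e3.
exists (maxn N1 N2) => N; rewrite geq_max => /andP[/h1 {}h1 /h2 {}h2].
apply: le_lt_trans (nc_ReIm _) _; rewrite Re_add Im_add Re_opp Im_opp /=.
by move: h1 h2; move: `|_| `|_| => x y; lra.
Qed.

End Limits.

Section Backward.
Variable R : realType.
Local Notation C := R[i].
Variable n : nat.
Implicit Types (P : 'X_{1..n} -> {mpoly C[n]}) (v : 'I_(n + n) -> C).

Definition rt (k : nat) (a : 'X_{1..n}) : R :=
  (ffact_mnm (cst_mnm n k) a)%:R / k%:R ^+ mdeg a.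

(* The polynomial [T_(k,..,k) F] evaluated at [(z, w / k)]. *)
Definition approx P k : {mpoly C[n + n]} :=
  ser (fun a => (rt k a)%:C%C) P (mdeg (cst_mnm n k)).+1.

Lemma rt_eq0 k a : (mdeg (cst_mnm n k) < mdeg a)%N -> rt k a = 0.
Proof. by move=> h; rewrite /rt ffact_mnm_eq0 // mul0r. Qed.

Lemma mcoeff_approx P k nu :
  (approx P k)@_nu = (rt k (wmnm nu))%:C%C * (P (wmnm nu))@_(zmnm nu).
Proof.
by rewrite mcoeff_ser; case: ltnP => // h; rewrite rt_eq0 // mul0r.
Qed.

Lemma meval_approx P k N v : (mdeg (cst_mnm n k) < N)%N ->
  (approx P k).@[v] = \sum_(a : 'X_{1..n < N}) (rt k a)%:C%C * series_term P a v.
Proof.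
move=> h; rewrite meval_ser; apply/esym/eqP; rewrite -subr_eq0.
rewrite (sum_bmnm_split (fun a => (rt k a)%:C%C * series_term P a v) h).
by apply/eqP; rewrite big1 // => a ha; rewrite rt_eq0 // mul0r.
Qed.

Lemma approx_stable P k : (0 < k)%N ->
  (forall b, trunc_poly P b = 0 \/ stable (trunc_poly P b)) ->
  approx P k = 0 \/ stable (approx P k).
Proof.
move=> k0 h; have r0 : forall i, 0 < zwjoin_real (n := n) 1 (k%:R^-1 : R) i.
  by apply: zwjoin_real_gt0; rewrite ?invr_gt0 ?ltr0n.
have := mmult_mon_stable r0 (h (cst_mnm n k)).
rewrite (_ : mmult _ _ = approx P k) //; apply/mpolyP => nu.
rewrite mcoeff_mmult mcoeff_trunc mcoeff_approx mon_zwjoin_real mulrA; congr (_ * _).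
by rewrite expr1n mul1r -(rmorph_nat (real_complex R)) -rmorphM /= exprVn mulrC.
Qed.

Lemma rt_close k a : (0 < k)%N -> `|rt k a - 1| <= (mdeg a)%:R ^+ 2 / k%:R /\ `|rt k a| <= 1.
Proof.
move=> k0; have [h1 /andP[h2 h3]] := @ffact_ratio R n k a k0; rewrite -/(rt k a) in h1 h2 h3.
by rewrite ler0_norm ?ger0_norm //; lra.
Qed.

Lemma mcoeff_mpoly0 m (p : {mpoly C[m]}) : p@_0%MM = p.@[fun=> 0].
Proof.
rewrite (meval_wide _ (leqnSn (msize p))).
have h0 : (mdeg (0%MM : 'X_{1..m}) < (msize p).+1)%N by rewrite mdeg0.
rewrite (bigD1 (BMultinom h0)) //= big1 => [|mu hmu].
  by rewrite addr0 /mon big1 ?mulr1 // => i _; rewrite mnm0E expr0.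
have [i hi] : exists i, mu i != 0%N.
  apply/existsP; rewrite -negb_forall; apply: contra hmu => /forallP h.
  by apply/eqP/val_inj/mnmP => i; rewrite /= mnm0E; apply/eqP/h.
by rewrite /mon (bigD1 i) //= expr0n (negbTE hi) mul0r mulr0.
Qed.

Section NonZero.
Variable P : 'X_{1..n} -> {mpoly C[n]}.
Hypothesis hP : forall b, trunc_poly P b = 0 \/ stable (trunc_poly P b).
Variables (d : nat) (a0 : 'X_{1..n}).
Hypothesis low : forall a, (mdeg a < d)%N -> P a = 0.
Hypothesis da0 : mdeg a0 = d.
Hypothesis Pa0 : P a0 != 0.

(** Times [i ^ d], this is the value at [(i,..,i; i,..,i)] of the part of [F] of lowest degree in
    [w]. *)
Let leadsum : C := \sum_(a : 'X_{1..n < d.+1} | mdeg a == d) (P a).@[fun=> 'i%C].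

(** For [k > d ^ 2] the ratio [rt k a0] differs from 1 by less than 1, so the contribution of [P a0]
    survives. *)
Lemma approx_stable_neq0 k : (0 < k)%N -> (d ^ 2 < k)%N -> stable (approx P k).
Proof.
move=> k0 dk; case: (approx_stable k0 hP) => // E0.
have [nu hnu] : exists mu, (P a0)@_mu != 0.
  exists (mlead (P a0)); rewrite -mcoeff_msupp; exact: mlead_supp.
have := congr1 (fun p : {mpoly C[n + n]} => p@_(join_mnm nu a0)) E0.
rewrite mcoeff_approx wmnm_join zmnm_join mcoeff0 => /eqP.
rewrite mulf_eq0 (negbTE hnu) orbF -nc_eq0 nc_real normr_eq0 => /eqP r0.
have [+ _] := rt_close a0 k0; rewrite r0 sub0r normrN1 da0.
by rewrite ler_pdivlMr ?ltr0n // mul1r -natrX ler_nat leqNgt dk.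
Qed.

(** Moves the centre of expansion [(i,..,i; 0,..,0)] to the origin. *)
Let shiftP a := shift 'i%C (P a).

(** The part [q] of [F] of lowest degree in [w] is a limit of the corresponding parts of the stable
    [approx P k], hence stable, hence nonzero at [(i,..,i; i,..,i)]. *)
Lemma leadsum_neq0 : leadsum != 0.
Proof.
pose q := ser (fun a => (mdeg a == d)%:R) P d.+1.
have cq nu : q@_nu = (mdeg (wmnm nu) == d)%:R * (P (wmnm nu))@_(zmnm nu).
  by rewrite mcoeff_ser; case: ltnP => // h; rewrite (gtn_eqF h) mul0r.
have wE nu : mwt (fun i : 'I_(n + n) => if split i is inl _ then false else true) nu = mdeg (wmnm nu).
  rewrite /mwt big_mkcond big_split_ord /= [X in (X + _)%N]big1 => [|i _]; last first.
    by rewrite (unsplitK (inl i)).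
  by rewrite add0n mdegE; apply: eq_bigr => i _; rewrite (unsplitK (inr i)) mnmE.
have q0 : q != 0.
  apply: contraNneq Pa0 => q0; apply/eqP/mpolyP => mu; rewrite mcoeff0.
  have := cq (join_mnm mu a0); rewrite q0 mcoeff0 wmnm_join zmnm_join da0 eqxx mul1r.
  by [].
have qst : stable q.
  suff [E|//] : q = 0 \/ stable q by rewrite E eqxx in q0.
  apply: (@hurwitz_coef _ _ (msize q)) => // e e0.
  pose M : R := \sum_(nu <- msupp q) d%:R ^+ 2 * nc q@_nu.
  have M0 : 0 <= M by apply: sumr_ge0 => nu _; rewrite mulr_ge0 ?nc_ge0 ?sqr_ge0.
  pose k := ((Num.trunc (M / e)).+1 + d ^ 2)%N.
  have k0 : (0 < k)%N by rewrite /k addSn.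
  have K0 : 0 < k%:R :> R by rewrite ltr0n.
  have Mk : M / k%:R <= e.
    rewrite ler_pdivrMr // -ler_pdivrMl // mulrC; apply: le_trans (ltW (truncnS_gt _)) _.
    by rewrite ler_nat leq_addr.
  have dk : (d ^ 2 < k)%N by rewrite /k addSn ltnS leq_addl.
  exists (mmult (fun mu => (mwt (fun i : 'I_(n + n) => if split i is inl _ then false else true) mu == d)%:R)
    (approx P k)); split.
  - apply: lowest_part_stable; last exact: approx_stable_neq0.
    by move=> nu; rewrite wE mcoeff_approx => /low ->; rewrite mcoeff0 mulr0.
  - apply: msize_leP => nu; rewrite mcoeff_mmult wE mcoeff_approx => h; rewrite ltnS ltnW //.
    apply: msize_mdeg_lt; rewrite mcoeff_msupp cq; apply: contraNneq h => h.
    by rewrite mulrCA h mulr0.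
  move=> nu; rewrite mcoeff_mmult wE mcoeff_approx mulrCA -cq -[X in _ - X]mul1r -mulrBl.
  rewrite ncM -(rmorph1 (real_complex R)) -rmorphB nc_real.
  have [hin|hin] := boolP (nu \in msupp q); last first.
    by rewrite (memN_msupp_eq0 hin) Normc.normc0 mulr0 ltW.
  have hd : mdeg (wmnm nu) = d.
    have [//|h] := eqVneq (mdeg (wmnm nu)) d.
    by move: hin; rewrite mcoeff_msupp cq (negbTE h) mul0r eqxx.
  apply: le_trans Mk; apply: (@le_trans _ _ (d%:R ^+ 2 / k%:R * nc q@_nu)).
    by rewrite ler_wpM2r ?nc_ge0 //; have [] := rt_close (wmnm nu) k0; rewrite hd.
  rewrite mulrAC ler_pM2r ?invr_gt0 // /M (bigD1_seq nu) ?msupp_uniq //= lerDl.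
  by apply: sumr_ge0 => i _; rewrite mulr_ge0 ?nc_ge0 ?sqr_ge0.
(* The factor 1 exhibits the [w]-coordinates as a multiple, so that [mon_scale] extracts [i ^ d]. *)
pose v := zwjoin (fun _ : 'I_n => 'i%C : C) (fun=> 'i%C * 1).
have : q.@[v] != 0.
  apply: (proj1 (stableP q) qst); apply: (zwjoin_ind (Q := fun x => 0 < Im x)) => i /=.
    exact: ltr01.
  by rewrite mul0r mul1r add0r ltr01.
suff -> : q.@[v] = 'i%C ^+ d * leadsum by rewrite mulf_eq0 negb_or => /andP[].
rewrite meval_ser /leadsum mulr_sumr [RHS]big_mkcond; apply: eq_bigr => a _.
have m1 : mon a (fun=> 1 : C) = 1 by rewrite /mon big1 // => i _; exact: expr1n.
rewrite series_term_join mon_scale m1 mulr1.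
by case: eqP => [->|_]; rewrite ?mul0r // mul1r mulrC.
Qed.

Lemma meval_approx_shift k v : (approx shiftP k).@[v] =
  (approx P k).@[zwjoin (fun i => zpart v i + 'i%C) (wpart v)].
Proof.
rewrite !(meval_approx _ _ (ltnSn _)); apply: eq_bigr => a _; congr (_ * _).
by rewrite series_term_join /series_term /shiftP meval_shift.
Qed.

(** All terms have [w]-degree at least [d], so those of total degree [d] are constant in [z]; the
    constant term of [shiftP a] is [P_a(i,..,i)]. *)
Lemma meval_hompart_approx_shift k : (hompart d (approx shiftP k)).@[fun=> 1] =
  \sum_(a : 'X_{1..n < d.+1} | mdeg a == d) (rt k a)%:C%C * (P a).@[fun=> 'i%C].
Proof.
have -> : hompart d (approx shiftP k) = ser (fun a => (mdeg a == d)%:R * (rt k a)%:C%C)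
    (fun a => ((shiftP a)@_0%MM)%:MP) d.+1.
  apply/mpolyP => nu; rewrite mcoeff_hompart mcoeff_approx mcoeff_ser mcoeffC mdeg_zw -mulrA.
  case: (ltngtP (mdeg (wmnm nu)) d) => h.
  - by rewrite ltnS ltnW // /shiftP (low h) /shift comp_mpoly0 !mcoeff0 !mul0r !mulr0.
  - rewrite ltnNge h /= (_ : (_ == d) = false) ?mul0r //; apply: gtn_eqF.
    exact: leq_trans h (leq_addl _ _).
  rewrite h ltnSn mul1r -[X in _ == X]add0n eqn_add2r mdeg_eq0.
  by case: eqP => [->|_]; rewrite ?mul1r ?mulr1 // mul0r !mulr0.
rewrite meval_ser [RHS]big_mkcond; apply: eq_bigr => a _.
rewrite /series_term mevalC big1 => [|i _]; last by rewrite /wpart expr1n.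
rewrite mulr1 mcoeff_mpoly0 /shiftP meval_shift.
rewrite (meval_eq (v2 := fun=> 'i%C)) => [|i]; last by rewrite add0r.
by case: eqP; rewrite ?mul1r ?mul0r.
Qed.

Lemma approx_bounded : exists k0, (d ^ 2 < k0)%N /\ forall rho : R, 0 <= rho -> exists B : R,
  forall k v, (k0 <= k)%N -> (forall i, nc (v i) <= rho) -> nc (approx P k).@[v] <= B.
Proof.
pose X : R := \sum_(a : 'X_{1..n < d.+1}) d%:R ^+ 2 * nc (P a).@[fun=> 'i%C].
have X0 : 0 <= X by apply: sumr_ge0 => a _; rewrite mulr_ge0 ?sqr_ge0 ?nc_ge0.
have L0 : 0 < nc leadsum by rewrite nc_gt0 leadsum_neq0.
(* Above [d ^ 2] the approximants are stable; above [2 X / |leadsum|] the value of their lowest part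
   at [(1,..,1)] keeps half the modulus of [leadsum]. *)
pose k0 := ((Num.trunc (2 * X / nc leadsum)).+1 + d ^ 2)%N.
have dk0 : (d ^ 2 < k0)%N by rewrite /k0 addSn ltnS leq_addl.
exists k0; split=> // rho rho0.
(* Bounds the coefficients up to degree [d + 2] for all [k] at once, since [|rt k a| <= 1]. *)
pose M : R := \sum_(nu : 'X_{1..(n + n) < d.+3}) nc (shiftP (wmnm nu))@_(zmnm nu).
have rho1 : 0 <= rho + 1 by lra.
have dl0 : 0 < nc leadsum / 2 by lra.
have [B hB] := stable_growth (n + n) d M dl0 rho1.
exists B => k v k0k hv.
have dk : (d ^ 2 < k)%N := leq_trans dk0 k0k.
have kpos : (0 < k)%N := leq_ltn_trans (leq0n _) dk.
have K0 : 0 < k%:R :> R by rewrite ltr0n.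
pose v' := zwjoin (fun i => zpart v i - 'i%C) (wpart v).
have -> : (approx P k).@[v] = (approx shiftP k).@[v'].
  rewrite meval_approx_shift; apply: meval_eq => i.
  rewrite -[i in LHS]splitK /zwjoin; case: (split i) => j /=.
    by rewrite zpart_join subrK.
  by rewrite wpart_join.
apply: hB.
- apply/stableP => w hw; rewrite meval_approx_shift.
  apply: (proj1 (stableP _) (approx_stable_neq0 kpos dk)).
  apply: (zwjoin_ind (Q := fun x => 0 < Im x)) => i; last exact: hw.
  by rewrite Im_add /= addr_gt0 // hw.
- move=> nu h; rewrite mcoeff_approx /shiftP low ?/shift ?comp_mpoly0 ?mcoeff0 ?mulr0 //.
  by apply: leq_ltn_trans h; rewrite mdeg_zw leq_addl.
- rewrite meval_hompart_approx_shift; set S := \sum_(a | _) _.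
  have hX : X / k%:R <= nc leadsum / 2.
    have : 2 * X / nc leadsum <= k%:R.
      apply: le_trans (ltW (truncnS_gt _)) _.
      by rewrite ler_nat; apply: leq_trans k0k; rewrite leq_addr.
    rewrite ler_pdivrMr // ler_pdivrMr // mulrAC ler_pdivlMr //.
    by rewrite mulrC [nc _ * _]mulrC.
  have hS : nc (leadsum - S) <= nc leadsum / 2.
    rewrite /leadsum /S -sumrB; apply: le_trans (nc_sum _ _ _) _.
    apply: (@le_trans _ _ (X / k%:R)); last first.
      exact: hX.
    rewrite /X mulr_suml big_mkcond; apply: ler_sum => a _.
    case: eqP => [ad|_]; last by rewrite divr_ge0 ?mulr_ge0 ?sqr_ge0 ?nc_ge0 // ltW.
    rewrite -[X in X - _]mul1r -mulrBl ncM -(rmorph1 (real_complex R)) -rmorphB nc_real distrC.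
    by rewrite mulrAC ler_wpM2r ?nc_ge0 //; have [] := rt_close a kpos; rewrite ad.
  have hl := ncD S (leadsum - S); rewrite addrC subrK in hl.
  have -> : nc leadsum / 2 = nc leadsum - nc leadsum / 2 by field.
  by rewrite lerBlDr; apply: le_trans hl _; rewrite lerD2l.
- move=> nu hnu; rewrite mcoeff_approx ncM nc_real.
  have hnu' : (mdeg nu < d.+3)%N by [].
  apply: (@le_trans _ _ (1 * nc (shiftP (wmnm nu))@_(zmnm nu))).
    by rewrite ler_wpM2r ?nc_ge0 //; have [] := rt_close (wmnm nu) kpos.
  rewrite mul1r /M (bigD1 (BMultinom hnu')) //= lerDl sumr_ge0 // => i _; exact: nc_ge0.
apply: (zwjoin_ind (Q := fun x => nc x <= rho + 1)) => i.
  by apply: le_trans (ncB _ _) _; rewrite nc_i lerD2r; exact: hv.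
by apply: le_trans (hv _) _; lra.
Qed.

(** Cauchy's estimate in [w] with radius [2 rho] gives the factor [2 ^ -|a|]. The index [k] may
    depend on [a], because [B] does not depend on [k]; it is taken so large that [rt k a >= 1 / 2],
    which costs the factor 2. *)
Lemma series_term_decay (rho : R) : 0 < rho -> exists B : R, forall v a,
  (forall i, nc (v i) <= rho) -> nc (series_term P a v) <= B * 2^-1 ^+ mdeg a.
Proof.
move=> rho0; have [k0 [dk0 hk0]] := approx_bounded.
have r0 : 0 <= 2 * rho by lra.
have [B hB] := hk0 _ r0; exists (2 * B) => v a hv.
pose k := (k0 + 2 * mdeg a ^ 2)%N.
have kpos : (0 < k)%N by apply: leq_trans (leq_ltn_trans (leq0n _) dk0) _; rewrite leq_addr.
have K0 : 0 < k%:R :> R by rewrite ltr0n.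
have r12 : 2^-1 <= rt k a.
  have [+ _] := rt_close a kpos; rewrite ler_norml => /andP[+ _].
  have : (mdeg a)%:R ^+ 2 / k%:R <= 2^-1 :> R.
    have : 2 * (mdeg a)%:R ^+ 2 <= k%:R :> R by rewrite -natrX -natrM ler_nat leq_addl.
    by rewrite ler_pdivrMr //; lra.
  lra.
pose N := (mdeg (cst_mnm n k)).+1.
pose q : {mpoly C[n]} := \sum_(c : 'X_{1..n < N}) ((rt k c)%:C%C * (P c).@[zpart v]) *: 'X_[c].
have aN : (mdeg a < N)%N.
  rewrite ltnNge; apply/negP => h; move: r12; rewrite rt_eq0 //.
  by rewrite leNgt invr_gt0 ltr0n.
have qa : q@_a = (rt k a)%:C%C * (P a).@[zpart v].
  by rewrite (mcoeff_mpoly (fun c => (rt k c)%:C%C * (P c).@[zpart v])).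
have qb w : (forall i, nc (w i) <= 2 * rho) -> nc q.@[w] <= B.
  move=> hw; have -> : q.@[w] = (approx P k).@[zwjoin (zpart v) w].
    rewrite (meval_approx _ _ (ltnSn _)) /q raddf_sum /=; apply: eq_bigr => c _.
    by rewrite mevalZ mevalX series_term_join mulrA.
  apply: hB; first by rewrite leq_addr.
  apply: (zwjoin_ind (Q := fun x => nc x <= 2 * rho)) => // i.
  by apply: le_trans (hv _) _; lra.
have := @cauchy_mpoly _ _ q (2 * rho) B a r0 qb; rewrite qa ncM nc_real => h.
have h1 : nc (P a).@[zpart v] * (2 * rho) ^+ mdeg a <= 2 * B.
  have p0 : 0 <= nc (P a).@[zpart v] * (2 * rho) ^+ mdeg a by rewrite mulr_ge0 ?nc_ge0 ?exprn_ge0.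
  move: h; rewrite -mulrA ger0_norm; last by lra.
  by move: r12 p0; move: (_ * _ ^+ _) (rt _ _) => x y; nra.
rewrite exprVn ler_pdivlMr ?exprn_gt0 //; apply: le_trans h1.
rewrite nc_series_term -mulrA ler_wpM2l ?nc_ge0 // exprMn mulrC ler_wpM2l ?exprn_ge0 //.
rewrite mdegE -prodrXr; apply: ler_prod => i _.
by rewrite exprn_ge0 ?nc_ge0 // lerXn2r ?nnegrE ?nc_ge0 ?(ltW rho0) //=; exact: hv.
Qed.

Lemma series_in_Hbar_neq0 : exists f, series_defines P f /\ Hbar_C f.
Proof.
have rho_of v : exists2 r : R, 0 < r & forall i, nc (v i) <= r.
  exists (1 + \sum_i nc (v i)) => [|i]; first by rewrite ltr_pwDl // sumr_ge0 // => i _; exact: nc_ge0.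
  rewrite (bigD1 i) //= addrCA lerDl addr_ge0 // sumr_ge0 // => j _; exact: nc_ge0.
have conv v : exists l, forall e : R, 0 < e ->
    exists N0, forall N, (N0 <= N)%N -> nc (partial_sum P N v - l) < e.
  apply: complex_cauchy_limit => e e0; have [r r0 hr] := rho_of v.
  have [B hB] := series_term_decay r0.
  have B0 : 0 < `|B| + 1 by rewrite ltr_wpDl.
  have [N0 hN0] := @mdeg_tail_small R n (e / (`|B| + 1)) (divr_gt0 e0 B0).
  exists N0 => N hN; apply: le_trans (partial_sum_tail _ _ hN) _.
  apply: (@le_trans _ _ ((`|B| + 1) *
      \sum_(a : 'X_{1..n < N} | (N0 <= mdeg a)%N) 2^-1 ^+ mdeg a)).
    rewrite mulr_sumr; apply: ler_sum => a _; apply: le_trans (hB v a hr) _.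
    by rewrite ler_wpM2r ?exprn_ge0 ?invr_ge0 //; have := ler_norm B; lra.
  by rewrite mulrC -ler_pdivlMr // hN0.
have [f hf] := boolp.choice conv.
exists f; split=> [v|].
  split; last by move=> e /(hf v)[N0 h]; exists N0 => N /h; rewrite norm_ltC.
  have [r r0 hr] := rho_of v; have [B hB] := series_term_decay r0.
  exists (`|B| * 2 ^+ n) => N.
  rewrite (eq_bigr (fun a : 'X_{1..n < N} => (nc (series_term P a v))%:C%C)) //.
  rewrite -rmorph_sum lecR; apply: (@le_trans _ _ (\sum_(a : 'X_{1..n < N}) `|B| * 2^-1 ^+ mdeg a)).
    apply: ler_sum => a _; apply: le_trans (hB v a hr) _.
    by rewrite ler_wpM2r ?exprn_ge0 ?invr_ge0 // ler_norm.
  by rewrite -mulr_sumr ler_wpM2l // sum_mdeg_geom.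
(* The shift of the index makes every approximant stable. *)
exists (fun k => approx P (k + (d ^ 2).+1)); split=> [k|r e e0].
  by apply: approx_stable_neq0; rewrite addnS // ltnS leq_addl.
have r0 : 0 < `|r| + 1 by rewrite ltr_wpDl.
have [B hB] := series_term_decay r0.
pose V v := forall i, nc (v i) <= `|r| + 1.
have e4 : 0 < e / 4 by lra.
have [N1 hN1] := uniform_tail (V := V) (fun v a hv => hB v a hv) (fun v e _ e0 => hf v e e0) e4.
have B0 : 0 < `|B| + 1 by rewrite ltr_wpDl.
have [N2 hN2] := @mdeg_tail_small R n (e / 4 / (`|B| + 1)) (divr_gt0 e4 B0).
pose Y : R := N2%:R ^+ 2 * ((`|B| + 1) * 2 ^+ n).
exists (Num.trunc (Y / (e / 4))).+1 => k hk v hv.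
set j := (k + _)%N; have j0 : (0 < j)%N by rewrite /j addnS.
have J0 : 0 < j%:R :> R by rewrite ltr0n.
have Yj : Y / j%:R <= e / 4.
  rewrite ler_pdivrMr // -ler_pdivrMl // mulrC; apply: le_trans (ltW (truncnS_gt _)) _.
  by rewrite ler_nat; apply: leq_trans hk _; rewrite leq_addr.
have hV : V v.
  by move=> i; have := hv i; rewrite norm_leC => h; apply: le_trans h _; have := ler_norm r; lra.
pose N := maxn (maxn N1 N2) (mdeg (cst_mnm n j)).+1.
have jN : (mdeg (cst_mnm n j) < N)%N by rewrite leq_maxr.
have N1N : (N1 <= N)%N by rewrite /N -maxnA leq_maxl.
have N2N : (N2 <= N)%N by rewrite /N maxnAC leq_maxr.
rewrite norm_ltC; apply: (@le_lt_trans _ _ (e / 4 + e / 4 + e / 4)); last by lra.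
apply: le_trans (ncBD _ (partial_sum P N v) _) _; apply: lerD; last exact: hN1.
rewrite (meval_approx _ _ jN) /partial_sum -sumrB.
apply: le_trans (nc_sum _ _ _) _.
(* Below degree [N2] the ratio [rt j a] is within [N2 ^ 2 / j] of 1; from [N2] on the terms
   themselves form a small geometric tail. *)
apply: (@le_trans _ _ (\sum_(a : 'X_{1..n < N}) (N2%:R ^+ 2 / j%:R * (`|B| + 1)) * 2^-1 ^+ mdeg a +
    (`|B| + 1) * \sum_(a : 'X_{1..n < N} | (N2 <= mdeg a)%N) 2^-1 ^+ mdeg a)); last first.
  apply: lerD; last by rewrite mulrC -ler_pdivlMr // hN2.
  apply: le_trans Yj; rewrite -mulr_sumr.
  have -> : Y / j%:R = N2%:R ^+ 2 / j%:R * (`|B| + 1) * 2 ^+ n by rewrite /Y; ring.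
  rewrite ler_wpM2l ?sum_mdeg_geom // mulr_ge0 ?divr_ge0 ?sqr_ge0 // ltW //.
rewrite mulr_sumr [X in _ + X]big_mkcond -big_split; apply: ler_sum => a _ /=.
rewrite -[X in _ - X]mul1r -mulrBl ncM -(rmorph1 (real_complex R)) -rmorphB nc_real.
have p0 : 0 <= (2^-1 : R) ^+ mdeg a by rewrite exprn_ge0 // invr_ge0.
have ht : nc (series_term P a v) <= (`|B| + 1) * 2^-1 ^+ mdeg a.
  apply: le_trans (hB v a hV) _; rewrite ler_wpM2r //; have := ler_norm B; lra.
have [c1 c2] := rt_close a j0.
have q0 : 0 <= N2%:R ^+ 2 / j%:R * (`|B| + 1) * 2^-1 ^+ mdeg a :> R.
  by rewrite !mulr_ge0 ?invr_ge0 ?sqr_ge0 // ltW.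
case: leqP => ha.
  apply: le_trans (_ : _ <= 1 * nc (series_term P a v)) _.
    rewrite ler_wpM2r ?nc_ge0 //.
    have [_ /andP[h2 h3]] := @ffact_ratio R n j a j0; rewrite -/(rt j a) in h2 h3.
    by rewrite ler0_norm; lra.
  by rewrite mul1r; lra.
rewrite addr0 -mulrA ler_pM ?nc_ge0 //; apply: le_trans c1 _.
by rewrite ler_pM2r ?invr_gt0 // lerXn2r ?nnegrE // ler_nat ltnW.
Qed.

End NonZero.

Lemma trunc_series_in_Hbar P :
  (forall b, trunc_poly P b = 0 \/ stable (trunc_poly P b)) ->
  exists f, series_defines P f /\ Hbar_C f.
Proof.
move=> hP; have [[b Pb]|P0] := boolp.pselect (exists a, P a != 0); last first.
  have term0 a v : series_term P a v = 0.
    have -> : series_term P a v = 0 * \prod_(i < n) wpart v i ^+ a i; last by rewrite mul0r.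
    congr (_ * _); case: (eqVneq (P a) 0) => [->|h]; first by rewrite meval0.
    by case: P0; exists a.
  exists (fun=> 0); split=> [v|].
    split; last first.
      move=> e e0; exists 0%N => N _; rewrite /partial_sum big1 ?subr0 ?normr0 ?ltcR //.
    by exists 0 => N; rewrite big1 // => a _; rewrite term0 normr0.
  (* The zero polynomial is not stable, so the zero function is approached by nonzero constants. *)
  exists (fun k => (k.+1%:R^-1)%:MP); split=> [k|r e e0].
    by move=> v _; rewrite mevalC invr_eq0 pnatr_eq0.
  exists (Num.trunc e^-1).+1 => k hk v _.
  rewrite mevalC subr0 norm_ltC ncV nc_nat invf_plt ?posrE ?ltr0n //.
  apply: lt_le_trans (truncnS_gt _) _; rewrite ler_nat; exact: leqW.
(* The lowest degree [d] of a nonzero [P a] is a least element, for which the predicate is made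
   boolean. *)
have ex : exists k, boolp.asbool (exists a, mdeg a = k /\ P a != 0).
  by exists (mdeg b); apply/boolp.asboolP; exists b.
case: (ex_minnP ex) => d /boolp.asboolP[a [da Pa]] dmin.
apply: (@series_in_Hbar_neq0 P hP d a) => // c hc.
apply/eqP/negPn/negP => Pc; move: hc; rewrite ltnNge => /negP; apply.
by apply: dmin; apply/boolp.asboolP; exists c.
Qed.

End Backward.

Theorem theorem5p1 (R : realType) (K : Kfield) (n : nat)
  (P : 'X_{1..n} -> {mpoly R[i][n]})
  (hP : forall a : 'X_{1..n}, mpoly_over K (P a)) :
  series_in_Hbar K P <->
  (forall b : 'X_{1..n}, trunc_poly P b = 0 \/ Hpoly K (trunc_poly P b)).
Proof.
split=> [[[f [hs hf]] _] b|h].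
  have [|st] := trunc_limit b hs hf; [by left|right].
  by split=> //; exact: trunc_over.
split=> //; apply: trunc_series_in_Hbar => b.
by case: (h b) => [->|[st _]]; [left|right].
Qed.
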